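(* Let $P:\{\pm1\}^k\to\{0,1\}$ be a $k$-ary Boolean predicate, let $t\ge2$ be an integer, and let $\nu$ be a $(t-1)$-wise uniform distribution over $\{\pm1\}^k$ such that there is a multiset $S\subseteq\{\pm1\}^k$ with $\nu(x)=\Pr_{s\sim S}(s=x)$ for each $x$. Suppose $\mathbb{E}_{x\sim\nu}[P(x)]=\beta>\mathbb{E}_{x\sim\{\pm1\}^k}[P(x)]$ (the latter under the uniform distribution). Then for any constant $\epsilon>0$ there exist an integer $r=O_{\epsilon,k}(|S|^4)$, a rational $\tilde\epsilon\le\epsilon$, and a $(t-1)$-wise uniform distribution $\theta$ over $\{\pm1\}^{r\times k}$ such that for every $y$ in the support of $\theta$, exactly $(\beta-\tilde\epsilon)r$ of the $r$ rows of $y$ satisfy $P$.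
   Context: A distribution on $\{\pm1\}^N$ is $s$-wise uniform if its marginal on every set of $s$ coordinates is uniform; for $\theta$ this refers to all $rk$ entries of the matrix. *)

(* Defs.v *)
From mathcomp Require Import all_boot all_order all_algebra.
From mathcomp Require Import reals.

Set Implicit Arguments.
Unset Strict Implicit.
Unset Printing Implicit Defensive.

Import Order.TTheory GRing.Theory Num.Theory.
Local Open Scope ring_scope.

(* {±1}^I, with b : bool standing for the sign (-1)^b. *)
Definition cube (I : finType) : finType := {ffun I -> bool}.

Section Distributions.
Variable R : realType.

Definition is_dist (T : finType) (mu : {ffun T -> R}) : Prop :=
  (forall x, 0 <= mu x) /\ \sum_x mu x = 1.

Definition unif (T : finType) : {ffun T -> R} := [ffun=> #|T|%:R^-1].

(* A multiset is given by a list; only multiplicities matter. For S = [::]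
   this is the zero function, which is not a distribution. *)
Definition unif_multiset (T : finType) (S : seq T) : {ffun T -> R} :=
  [ffun x => (count_mem x S)%:R / (size S)%:R].

(* E_{x ~ mu}[P x], for a 0/1-valued P. *)
Definition expect (T : finType) (mu : {ffun T -> R}) (P : T -> bool) : R :=
  \sum_x mu x * (P x)%:R.

Definition restrict (I : finType) (A : {set I}) (x : cube I) :
  cube {i : I | i \in A} := [ffun i => x (val i)].

Definition marginal (I : finType) (A : {set I}) (mu : {ffun cube I -> R}) :
  {ffun cube {i : I | i \in A} -> R} :=
  [ffun z => \sum_(x | restrict A x == z) mu x].

Definition wise_uniform (I : finType) (s : nat) (mu : {ffun cube I -> R}) :
  Prop := forall A : {set I}, #|A| = s -> marginal A mu = unif _.

End Distributions.

Definition row_of (r k : nat) (y : cube ('I_r * 'I_k)%type) (i : 'I_r) :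
  cube 'I_k := [ffun j => y (i, j)].

(* Main.v *)
Require Import Defs.
From mathcomp Require Import boolp classical_sets.
From mathcomp Require Import all_boot all_order all_algebra all_fingroup.
From mathcomp Require Import reals ring lra zify.
Set Implicit Arguments.
Unset Strict Implicit.
Unset Printing Implicit Defensive.
Import Order.TTheory GRing.Theory Num.Theory.
Local Open Scope ring_scope.

(** Put [s = t - 1], [M = size S], [b = count P S], [B = 2 ^ k], [D = b * B - #|P| * M].
   Restrict the uniform [n x k] matrices to those in which every [x] occurs among the
   rows almost [n / B] times and the number of rows satisfying [P] has a prescribed
   residue mod [D]. This set supports an exactly [s]-wise uniform [Z]: up to an error
   exponentially small in [n], the characters are orthogonal on it, so the density is
   found by solving a diagonally dominant linear system. The integer function
   [B * count_mem x S - M] on rows is orthogonal to all functions of at most [s]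
   coordinates and has total mass [D] on [P]; adding a multiple of it to the histogram of the rows
   of a matrix in the support brings the number of rows satisfying [P] to a fixed value
   close to [b / M * n]. Rearranging the rows at random, the law depends on the
   histogram only, and [s]-wise uniformity only on the low-degree moments of the
   histogram, which have not changed.

   This yields rates arbitrarily close to [b / M] with no control on [n]. For fixed
   [eps], [k], [P] and [s], a single [n] whose rate is nearly the supremum of the
   achievable ones serves all [S], and there are finitely many [P] and [s <= k]; so [r]
   is bounded independently of [S]. For [s > k] one row suffices, as [s]-wise uniformity
   on it is vacuous. *)

(** * Permanents and low-degree power sums *)

Section PermSum.
Variables (R : realType) (K : finType) (n : nat).
Implicit Types (f : 'I_n -> cube K -> R) (y : 'I_n -> cube K).

Definition depends_on (A : {set K}) (f : cube K -> R) :=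
  forall x x' : cube K, {in A, x =1 x'} -> f x = f x'.

Lemma depends_onM A B (f g : cube K -> R) :
  depends_on A f -> depends_on B g -> depends_on (A :|: B) (fun x => f x * g x).
Proof.
move=> fA gB x x' xx'; congr (_ * _); first by apply: fA => a aA; rewrite xx' ?inE ?aA.
by apply: gB => a aB; rewrite xx' ?inE ?aB ?orbT.
Qed.

(** The permanent of the matrix with entries [f i (y j)]. *)
Definition perm_sum f y : R := \sum_(s : 'S_n) \prod_i f i (y (s i)).

Lemma eq_perm_sum f g y : (forall i x, f i x = g i x) -> perm_sum f y = perm_sum g y.
Proof. by move=> fg; rewrite /perm_sum; apply: eq_bigr => s _; apply: eq_bigr => i _. Qed.

Lemma perm_sum_relabel (t : 'S_n) f y : perm_sum (fun i => f (t i)) y = perm_sum f y.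
Proof.
rewrite /perm_sum [RHS](reindex_inj (mulgI t^-1)%g) /=; apply: eq_bigr => s _.
rewrite [RHS](reindex_inj (@perm_inj _ t)) /=.
by apply: eq_bigr => i _; rewrite permM permK.
Qed.

(** For each [s] the second factor equals the sum over [j] of [g (y (s j))], and each summand is
    absorbed into the [j]-th factor of the product. *)
Lemma perm_sum_mul f (g : cube K -> R) y :
  perm_sum f y * \sum_i g (y i) =
  \sum_j perm_sum (fun i x => if i == j then f i x * g x else f i x) y.
Proof.
rewrite /perm_sum exchange_big big_distrl /=; apply: eq_bigr => s _.
rewrite [X in _ * X](reindex_inj (@perm_inj _ s)) big_distrr /=; apply: eq_bigr => j _.
rewrite (bigD1 j) // [RHS](bigD1 j) //= eqxx mulrAC; congr (_ * _).
by apply: eq_bigr => i /negbTE->.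
Qed.

(** As in Newton's identities, the permanent is determined by the power sums of products of the
    [f i]. The induction is on the number of nontrivial [f i]: one of them is taken out, and the
    permanent of the others is multiplied by its power sum. This gives a positive multiple of the
    wanted permanent, plus permanents in which two functions have merged. Merging does not raise the
    total degree. *)
Lemma perm_sum_low_degree d y y' :
  (forall (A : {set K}) g, (#|A| <= d)%N -> depends_on A g ->
     \sum_i g (y i) = \sum_i g (y' i)) ->
  forall f (A : 'I_n -> {set K}), (forall i, depends_on (A i) (f i)) ->
  (forall i, A i = set0 -> forall x, f i x = 1) ->
  (\sum_i #|A i| <= d)%N -> perm_sum f y = perm_sum f y'.
Proof.
move=> yy' f A fA fA0 leAd; pose J := [set i | A i != set0].
have fJ i : i \notin J -> forall x, f i x = 1 by rewrite inE negbK => /eqP/fA0.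
(* From here on [J] is any set outside which the [f i] are trivial, so that it can be replaced by
   [J :\ i0]. *)
move: {2}#|J| (leqnn #|J|) => l; clearbody J; clear fA0.
elim: l => [|l IHl] in f A J fA fJ leAd *.
  rewrite leqn0 cards_eq0 => /eqP J0.
  by rewrite /perm_sum; apply: eq_bigr => s _; rewrite !big1 // => i _; rewrite fJ // J0 inE.
move=> Jl; case: (set_0Vmem J) => [J0|[i0 i0J]].
  by apply: (IHl _ A J); rewrite // J0 cards0.
pose f' i x := if i == i0 then 1 else f i x.
pose A' i := if i == i0 then set0 else A i.
pose h j i x := if i == j then f' i x * f i0 x else f' i x.
have A'E : (\sum_i #|A' i| + #|A i0| = \sum_i #|A i|)%N.
  rewrite (bigD1 i0) // [RHS](bigD1 i0) //= /A' eqxx cards0 add0n addnC; congr (_ + _)%N.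
  by apply: eq_bigr => i /negbTE->.
have Jl' : (#|J :\ i0| <= l)%N by move: Jl; rewrite (cardsD1 i0) i0J.
have fA' i : depends_on (A' i) (f' i).
  by rewrite /A' /f'; case: eqP => // _ x x' _.
have fJ' i : i \notin J :\ i0 -> forall x, f' i x = 1.
  by rewrite !inE negb_and negbK /f'; case: eqP => //= _ /fJ.
have mulE z : perm_sum f' z * \sum_i f i0 (z i) =
    #|~: (J :\ i0)|%:R * perm_sum f z + \sum_(j in J :\ i0) perm_sum (h j) z.
  rewrite perm_sum_mul (bigID (mem (J :\ i0))) /= addrC; congr (_ + _).
  rewrite mulr_natl -sumr_const; apply: eq_big => j; first by rewrite !inE.
  move=> jJ.
  (* Placing [f i0] at an index [j] whose function is trivial merely exchanges the indices [i0] and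
     [j]. *)
  rewrite -(perm_sum_relabel (tperm i0 j) f).
  apply: eq_perm_sum => i x; rewrite /h /f'.
  case: (eqVneq j i0) => [->|ji0].
    by rewrite tperm1 perm1; case: eqVneq => [->|]; rewrite ?mul1r.
  have fj : forall x, f j x = 1 by apply: fJ; move: jJ; rewrite !inE ji0.
  case: tpermP => [->|->|/eqP/negbTE ii0 /eqP/negbTE ij].
  - by rewrite eqxx (eq_sym i0) (negbTE ji0) fj.
  - by rewrite eqxx (negbTE ji0) fj mul1r.
  - by rewrite ij ii0.
have c0 : #|~: (J :\ i0)|%:R != 0 :> R.
  by rewrite pnatr_eq0 cards_eq0; apply/set0Pn; exists i0; rewrite !inE eqxx.
apply: (mulfI c0); have := mulE y; have := mulE y'.
rewrite -(yy' (A i0)) //; last first.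
  by apply: leq_trans leAd; rewrite -A'E leq_addl.
rewrite -(IHl f' A' (J :\ i0)) //; last first.
  by apply: leq_trans leAd; rewrite -A'E leq_addr.
move=> ->; rewrite (eq_bigr (fun j => perm_sum (h j) y)); first by move/addIr.
move=> j; rewrite !inE => /andP[ji0 jJ].
apply/esym/(IHl _ (fun i => if i == j then A' i :|: A i0 else A' i) (J :\ i0)) => //.
- by move=> i; rewrite /h; case: eqP => _ //; apply: depends_onM.
- move=> i iJ x; rewrite /h fJ' //; case: eqVneq => // ij.
  by move: iJ; rewrite ij !inE ji0 jJ.
- apply: leq_trans leAd; rewrite -A'E (bigD1 j) //= eqxx.
  rewrite [X in (_ <= X + _)%N](bigD1 j) //= addnAC leq_add //.
    by rewrite cardsU leq_subr.
  by apply/eq_leq/eq_bigr => i /negbTE->.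
Qed.

End PermSum.

(** * Fourier analysis on the cube *)

Section Characters.
Variables (R : realType) (I : finType).
Implicit Types (A T : {set I}) (x y z : cube I) (mu : {ffun cube I -> R}).

(** The Walsh characters. *)
Definition chi T y : R := \prod_(i in T) (-1) ^+ y i.

Definition agree A z y := [forall i in A, y i == z i].

Lemma card_cube : #|cube I| = (2 ^ #|I|)%N.
Proof. by rewrite card_ffun card_bool. Qed.

Lemma restrict_eq A x z : (restrict A x == restrict A z) = agree A z x.
Proof.
apply/eqP/forall_inP => [xz i iA|xz].
  by move/ffunP/(_ (exist _ i iA)): xz; rewrite !ffunE => ->.
by apply/ffunP => -[i iA]; rewrite !ffunE /=; apply/eqP/xz.
Qed.

Lemma restrict_surj A (z' : cube {i : I | i \in A}) : exists z, restrict A z = z'.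
Proof.
exists [ffun i => if insub i is Some j then z' j else false].
by apply/ffunP => i; rewrite !ffunE valK.
Qed.

Lemma wise_uniformP s mu : wise_uniform s mu <->
  forall A z, #|A| = s -> \sum_(y | agree A z y) mu y = 2 ^- s.
Proof.
have unifE A (z' : cube {i : I | i \in A}) : unif R _ z' = 2 ^- #|A|.
  by rewrite ffunE card_ffun card_bool card_sig natrX.
have margE A z : marginal A mu (restrict A z) = \sum_(y | agree A z y) mu y.
  by rewrite ffunE; apply: eq_bigl => y; rewrite restrict_eq.
split=> [mu_s A z As|mu_s A As].
  by rewrite -margE mu_s // unifE As.
apply/ffunP => z'; have [z <-] := restrict_surj z'.
by rewrite margE unifE mu_s ?As.
Qed.

Lemma norm_chi T y : `|chi T y| = 1.
Proof. by rewrite normr_prod big1 // => i _; rewrite normrX normrN1 expr1n. Qed.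

Lemma chi0 y : chi set0 y = 1.
Proof. by rewrite /chi big_set0. Qed.

(** The indicator is the product over [i] in [A] of [(1 + (-1)^(y i) (-1)^(z i)) / 2]. Below, [F]
    and [G] are the two summands of a factor; since [F] vanishes off [A], only subsets of [A]
    survive in the expansion. *)
Lemma agreeE A z y :
  (agree A z y)%:R = \sum_(T : {set I} | T \subset A) 2 ^- #|A| * (chi T z * chi T y) :> R.
Proof.
pose F i : R := if i \in A then (-1) ^+ y i * (-1) ^+ z i / 2 else 0.
pose G i : R := if i \in A then 2^-1 else 1.
have -> : (agree A z y)%:R = \prod_i (F i + G i).
  have [/forall_inP yz|/forall_inPn[i iA yz]] := boolP (agree A z y).
    rewrite big1 // => i _; rewrite /F /G; case: ifP => [iA|]; last by rewrite add0r.
    by rewrite (eqP (yz i iA)) -exprD addnn -mul2n exprM sqrrN !expr1n; lra.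
  rewrite (bigD1 i) //= /F /G iA; move: yz.
  by case: (y i) (z i) => [] [] //= _; rewrite ?expr0 ?expr1; lra.
rewrite bigA_distr (bigID (fun T => [pred U : {set I} | U \subset A] T)) /= [X in _ + X]big1.
  rewrite addr0; apply: eq_big => [T|T TA]; first by [].
  rewrite /chi -big_split /= [in RHS]big_mkcond.
  have -> : 2 ^- #|A| = \prod_i G i.
    by rewrite /G -big_mkcond prodr_const exprVn.
  rewrite -big_split; apply: eq_bigr => i _ /=; rewrite /F /G.
  case: ifP => iT; last by rewrite mulr1.
  by rewrite (subsetP TA) //; ring.
move=> T /subsetPn[i iT iA].
by rewrite (bigD1 i) //= iT /F (negbTE iA) mul0r.
Qed.

(** After the expansion [agreeE] of the event, only the term of the empty set contributes. *)
Lemma wise_uniform_chi s mu :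
  (forall T, (#|T| <= s)%N -> \sum_y mu y * chi T y = (T == set0)%:R) ->
  wise_uniform s mu.
Proof.
move=> muchi; apply/wise_uniformP => A z As.
rewrite big_mkcond (eq_bigr (fun y =>
  \sum_(T : {set I} | T \subset A) 2 ^- #|A| * chi T z * (mu y * chi T y))) /=; last first.
  move=> y _; under eq_bigr do rewrite mulrCA mulrAC -mulrA.
  rewrite -mulr_sumr (_ : \sum_(_ | _) _ = (agree A z y)%:R).
    by case: agree; rewrite ?mulr1 ?mulr0.
  by rewrite agreeE; apply: eq_bigr => T _; ring.
rewrite exchange_big (bigD1 set0) ?sub0set //= [X in _ + X]big1 => [|T /andP[TA T0]].
  by rewrite -mulr_sumr muchi ?cards0 // eqxx chi0 As !mulr1 addr0.
by rewrite -mulr_sumr muchi -?As ?subset_leq_card // (negbTE T0) mulr0.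
Qed.

Lemma chi_orthogonal T T' :
  \sum_y chi T y * chi T' y = (2 ^ #|I|)%:R * (T == T')%:R.
Proof.
have -> : \sum_y chi T y * chi T' y =
    \prod_i \sum_(b : bool) (-1) ^+ (b && (i \in T)) * (-1) ^+ (b && (i \in T')).
  rewrite bigA_distr_bigA; apply: eq_bigr => y _.
  rewrite /chi big_mkcond [X in _ * X]big_mkcond -big_split.
  apply: eq_bigr => i _ /=.
  by case: (i \in T) (i \in T') => [] []; rewrite ?andbT ?andbF.
have [->|TT'] := eqVneq T T'.
  rewrite mulr1 natrX -prodr_const; apply: eq_bigr => i _.
  by rewrite big_bool /=; case: (i \in T'); rewrite /= ?expr0 ?expr1; lra.
have [i iTT'] : exists i, (i \in T) != (i \in T').
  apply/existsP; rewrite -negb_forall; apply: contra TT' => /forallP TT'.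
  by apply/eqP/setP => i; apply/eqP.
rewrite (bigD1 i) //= big_bool /= mulr0.
by move: iTT'; case: (i \in T) (i \in T') => [] []; rewrite //= ?expr0 ?expr1 => _; lra.
Qed.

Lemma sum_chi T : \sum_y chi T y = (2 ^ #|I|)%:R * (T == set0)%:R.
Proof. by rewrite -chi_orthogonal; apply: eq_bigr => y _; rewrite chi0 mulr1. Qed.

Lemma wise_uniform_unif s : wise_uniform s (unif R (cube I)).
Proof.
apply: wise_uniform_chi => T _.
under eq_bigr do rewrite ffunE card_cube.
rewrite -mulr_sumr sum_chi mulKf // pnatr_eq0 expn_eq0.
by [].
Qed.

Lemma superset_card A d : (#|A| <= d <= #|I|)%N -> exists2 B : {set I}, A \subset B & #|B| = d.
Proof.
move=> /andP[Ad dI]; exists (A :|: [set i | i \in take (d - #|A|) (enum [predC A])]).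
  exact: subsetUl.
rewrite cardsU (_ : A :&: _ = set0) ?cards0 ?subn0; last first.
  apply/setP => i; rewrite !inE; apply/negP => /andP[iA /mem_take].
  by rewrite mem_enum inE iA.
rewrite cardsE (card_uniqP _) ?take_uniq ?enum_uniq // size_takel ?subnKC //.
rewrite -cardE -(cardC A) in dI *; rewrite -(leq_add2l #|A|) subnKC //.
Qed.

(** Uniformity is given on sets of exactly [d] coordinates, so [A] is first enlarged to such a set
    [B]; then [f] is constant on the fibres of [restrict B]. *)
Lemma wise_uniform_low_degree d (mu nu : {ffun cube I -> R}) (A : {set I}) f :
  (d <= #|I|)%N -> wise_uniform d mu -> wise_uniform d nu ->
  (#|A| <= d)%N -> depends_on A f ->
  \sum_x mu x * f x = \sum_x nu x * f x.
Proof.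
move=> dI mud nud Ad fA.
have [|B AB Bd] := @superset_card A d; first by rewrite Ad.
have E (la : {ffun cube I -> R}) : \sum_x la x * f x =
    \sum_z' \sum_(x | restrict B x == z') la x * f x.
  by rewrite (partition_big (restrict B) predT).
rewrite !E; apply: eq_bigr => z' _; have [z <-] := restrict_surj z'.
have {}E (la : {ffun cube I -> R}) : \sum_(x | restrict B x == restrict B z) la x * f x =
    marginal B la (restrict B z) * f z.
  rewrite ffunE mulr_suml; apply: eq_bigr => x.
  rewrite restrict_eq => /forall_inP xz; congr (_ * _); apply: fA => i iA.
  by apply/eqP/xz/(subsetP AB).
by rewrite !E mud ?nud.
Qed.

End Characters.

(** * Exact orthogonality from approximate orthogonality *)

Section Correction.
Variables (R : realType) (Omega J : finType).

(* The density is a combination of the [f j], whose Gram matrix on [G] is diagonally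
   dominant; as that matrix is close to [p%:M], the constant coefficient dominates. *)
Lemma exists_orthogonal_density (f : J -> Omega -> R) (j0 : J) (G : {set Omega})
    (p eta : R) :
  (forall w, f j0 w = 1) -> (forall j w, `|f j w| <= 1) -> 0 < p ->
  (forall i j, `|\sum_(w in G) f i w * f j w - p * (i == j)%:R| <= eta) ->
  #|J|%:R * eta <= p / 2 ->
  exists Z : {ffun Omega -> R}, [/\ forall w, 0 <= Z w,
    forall w, Z w != 0 -> w \in G &
    forall j, \sum_w Z w * f j w = (j == j0)%:R].
Proof.
move=> f0 f1 p0 feta Jeta.
pose g i j := \sum_(w in G) f i w * f j w.
(* Diagonal dominance in l1 form: each coordinate loses at most [eta] times the norm of [v], hence
   all of them together at most [p / 2] times that norm. *)
have key (v : J -> R) :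
    p / 2 * \sum_j `|v j| <= \sum_i `|\sum_j v j * g j i|.
  have H i : p * `|v i| <= `|\sum_j v j * g j i| + eta * \sum_j `|v j|.
    rewrite -[p in p * _](gtr0_norm p0) -normrM.
    have -> : p * v i = \sum_j v j * g j i - \sum_j v j * (g j i - p * (j == i)%:R).
      rewrite -sumrB (bigD1 i) //= big1 ?addr0 => [|j ji].
        by rewrite eqxx mulr1 mulrBr opprB addrC subrK mulrC.
      by rewrite (negbTE ji) mulr0 subr0 subrr.
    apply: le_trans (ler_normB _ _) _; rewrite lerD2l.
    apply: le_trans (ler_norm_sum _ _ _) _; rewrite mulr_sumr.
    by apply: ler_sum => j _; rewrite normrM mulrC; apply: ler_wpM2r; rewrite ?feta.
  have : \sum_i p * `|v i| <= \sum_i (`|\sum_j v j * g j i| + eta * \sum_j `|v j|).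
    exact: ler_sum.
  rewrite -mulr_sumr big_split /= sumr_const -[_ *+ _]mulr_natl mulrA.
  have S0 : 0 <= \sum_j `|v j| by apply: sumr_ge0.
  have := ler_wpM2r S0 Jeta; set a := \sum_i `|\sum__ _|; set b := \sum_j _ in S0 *.
  by move=> h1 h2; lra.
pose M : 'M[R]_#|J| := \matrix_(i, j) g (enum_val i) (enum_val j).
pose fromrV (v : 'rV[R]_#|J|) j := v 0 (enum_rank j).
have mulE v j : (v *m M) 0 (enum_rank j) = \sum_i fromrV v i * g i j.
  rewrite mxE (reindex_onto enum_rank enum_val) /=; last by move=> i _; rewrite enum_valK.
  apply: eq_big => [i|i _]; first by rewrite enum_rankK eqxx.
  by rewrite mxE !enum_rankK.
have Munit : M \in unitmx.
  rewrite -row_free_unit; apply: inj_row_free => v vM.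
  have := key (fromrV v); rewrite [X in _ <= X]big1 => [le0|i _]; last first.
    by rewrite -mulE vM mxE normr0.
  have : \sum_j `|fromrV v j| == 0.
    rewrite eq_le sumr_ge0 // andbT -(@pmulr_rle0 _ (p / 2)) //; lra.
  rewrite psumr_eq0 // => /allP v0; apply/rowP => i; rewrite mxE.
  have := v0 (enum_val i); rewrite mem_index_enum /fromrV enum_valK normr_eq0.
  by move=> /(_ isT)/eqP.
pose v := fromrV (delta_mx 0 (enum_rank j0) *m invmx M).
have vE j : \sum_i v i * g i j = (j == j0)%:R.
  by rewrite -mulE mulmxKV // mxE eqxx (inj_eq enum_rank_inj).
(* The deviation of the solution [v] from that of the ideal system [p%:M]. Its l1 norm is at most
   [p^-1], the constant term of the ideal density, which makes the density nonnegative. *)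
pose z j := v j - (j == j0)%:R / p.
have zE j : \sum_i z i * g i j = - (g j0 j - p * (j0 == j)%:R) / p.
  under eq_bigr do rewrite mulrBl.
  rewrite sumrB vE (bigD1 j0) //= big1 ?addr0 => [|i /negbTE->]; last by rewrite !mul0r.
  have -> : (j == j0)%:R = (j0 == j)%:R :> R by rewrite eq_sym.
  by rewrite eqxx mulNr mulrBl opprB [p * _]mulrC mulfK ?gt_eqF // mul1r mulrC.
have z1 : \sum_j `|z j| <= p^-1.
  have : p / 2 * \sum_j `|z j| <= #|J|%:R * (eta / p).
    apply: le_trans (key z) _; rewrite mulr_natl -sumr_const; apply: ler_sum => j _.
    by rewrite zE normrM normrN normfV (gtr0_norm p0) ler_pM2r ?invr_gt0 ?feta.
  rewrite mulrA => h; have := le_trans h (ler_wpM2r _ Jeta).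
  by rewrite invr_ge0 (ltW p0) => /(_ isT); rewrite ler_pM2l //; lra.
exists [ffun w => if w \in G then \sum_j v j * f j w else 0]; split=> [w|w|j].
- rewrite ffunE; case: ifP => // _.
  have -> : \sum_j v j * f j w = p^-1 + \sum_j z j * f j w.
    rewrite (eq_bigr (fun j => (j == j0)%:R / p * f j w + z j * f j w)); last first.
      by move=> j _; rewrite /z; ring.
    rewrite big_split /= (bigD1 j0) //= big1 ?addr0 => [|j /negbTE->].
      by rewrite eqxx f0 !mul1r mulr1.
    by rewrite !mul0r.
  have : - \sum_j z j * f j w <= \sum_j `|z j|.
    apply: le_trans (ler_norm _) _; rewrite normrN.
    apply: le_trans (ler_norm_sum _ _ _) _; apply: ler_sum => j _.
    by rewrite normrM ler_piMr.
  by move: z1; lra.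
- by rewrite ffunE; case: ifP; rewrite ?eqxx.
- rewrite -vE (eq_bigr (fun w => \sum_i if w \in G then v i * (f i w * f j w) else 0)).
    rewrite exchange_big /=; apply: eq_bigr => i _.
    by rewrite -big_mkcond /= mulr_sumr.
  move=> w _; rewrite ffunE; case: ifP => _; last by rewrite mul0r big1.
  by rewrite mulr_suml; apply: eq_bigr => i _; rewrite mulrA.
Qed.

End Correction.

(** * Equidistribution of a count modulo [D] *)

Section CyclicMixing.
Variable R : realType.
Implicit Types phi : nat -> R.

(** One transfer step of a walk on the counts: weight [a] for staying, weight [b] for moving up by
    one. *)
Definition step (a b : R) phi s := a * phi s + b * phi s.+1.

Definition energy D phi := \sum_(s < D) phi s ^+ 2.

(** The linear functional on polynomials that takes ['X^j] to [phi j]. Multiplying its argument by a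
    linear polynomial amounts to a [step] on [phi]. *)
Definition poly_functional phi (p : {poly R}) := \sum_(j < size p) p`_j * phi j.

Lemma poly_functionalE phi (p : {poly R}) m :
  (size p <= m)%N -> poly_functional phi p = \sum_(j < m) p`_j * phi j.
Proof.
move=> pm; rewrite /poly_functional (big_ord_widen m (fun j => p`_j * phi j) pm).
rewrite big_mkcond; apply: eq_bigr => j _.
by case: ltnP => // pj; rewrite nth_default ?mul0r.
Qed.

Lemma poly_functionalD phi p q :
  poly_functional phi (p + q) = poly_functional phi p + poly_functional phi q.
Proof.
pose m := maxn (size p) (size q).
rewrite !(@poly_functionalE phi _ m) ?leq_maxl ?leq_maxr ?size_polyD //.
by rewrite -big_split; apply: eq_bigr => j _; rewrite coefD mulrDl.
Qed.

Lemma poly_functional0 phi : poly_functional phi 0 = 0.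
Proof. by rewrite /poly_functional size_poly0 big_ord0. Qed.

Lemma poly_functionalZ phi c p :
  poly_functional phi (c *: p) = c * poly_functional phi p.
Proof.
rewrite (poly_functionalE phi (size_scale_leq c p)) mulr_sumr.
by apply: eq_bigr => j _; rewrite coefZ mulrA.
Qed.

Lemma poly_functionalMX phi p :
  poly_functional phi (p * 'X) = poly_functional (fun s => phi s.+1) p.
Proof.
rewrite (@poly_functionalE phi _ (size p).+1); last first.
  by apply: leq_trans (size_polyMleq _ _) _; rewrite size_polyX addn2.
rewrite big_ord_recl coefMX mul0r add0r.
by apply: eq_bigr => j _; rewrite coefMX.
Qed.

Lemma poly_functionalXn phi j : poly_functional phi 'X^j = phi j.
Proof.
rewrite /poly_functional size_polyXn (bigD1 ord_max) //= coefXn eqxx mul1r big1 ?addr0 //.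
move=> i ij; rewrite coefXn (_ : (_ == j) = false) ?mul0r //.
by apply: contraNF ij => /eqP ij; apply/eqP/val_inj.
Qed.

Lemma poly_functional_step phi a b p :
  poly_functional phi ((a%:P + b *: 'X) * p) = poly_functional (step a b phi) p.
Proof.
rewrite mulrDl poly_functionalD mul_polyC -scalerAl !poly_functionalZ -commr_polyX.
rewrite poly_functionalMX /poly_functional !mulr_sumr -big_split.
by apply: eq_bigr => j _; rewrite /step /=; ring.
Qed.

Lemma poly_functional_prod phi (I : Type) (r : seq I) (a b : I -> R) :
  poly_functional phi (\prod_(i <- r) ((a i)%:P + b i *: 'X)) =
  foldl (fun ph i => step (a i) (b i) ph) phi r 0%N.
Proof.
elim: r phi => [|i r IHr] phi /=.
  by rewrite big_nil -(expr0 'X) poly_functionalXn.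
by rewrite big_cons poly_functional_step IHr.
Qed.

(** The generating polynomial of the count is a product of one linear factor per row, and
    [poly_functional phi] turns this product into iterated steps. *)
Lemma sum_ffun_step (X : finType) n (F : 'I_n -> X -> R) (P : pred X) phi :
  \sum_(w : {ffun 'I_n -> X}) (\prod_i F i (w i)) * phi (\sum_i P (w i))%N =
  foldl (fun ph i => step (\sum_(x | ~~ P x) F i x) (\sum_(x | P x) F i x) ph)
    phi (index_enum 'I_n) 0%N.
Proof.
rewrite -(poly_functional_prod _ _ (fun i => \sum_(x | ~~ P x) F i x)
  (fun i => \sum_(x | P x) F i x)).
have E i : (\sum_(x | ~~ P x) F i x)%:P + (\sum_(x | P x) F i x) *: 'X =
    \sum_x (F i x) *: 'X^(P x).
  rewrite [RHS](bigID P) /= addrC scaler_suml raddf_sum /=; congr (_ + _).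
    by apply: eq_bigr => x /negbTE->; rewrite expr0 alg_polyC.
  by apply: eq_bigr => x ->; rewrite expr1.
under [X in poly_functional _ X]eq_bigr do rewrite E.
rewrite bigA_distr_bigA (big_morph _ (poly_functionalD phi) (poly_functional0 phi)).
by apply: eq_bigr => w _; rewrite scaler_prod -expr_sum poly_functionalZ poly_functionalXn.
Qed.

Section Energy.
Variable D : nat.

Definition mean_zero_periodic phi :=
  (forall s, phi (s + D)%N = phi s) /\ \sum_(s < D) phi s = 0.

Lemma periodic_sum_shift phi : (forall s, phi (s + D)%N = phi s) ->
  \sum_(s < D) phi s.+1 = \sum_(s < D) phi s.
Proof.
case: D => [|D'] phiD; first by rewrite !big_ord0.
by rewrite big_ord_recr big_ord_recl /= -[D'.+1]add0n phiD addrC.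
Qed.

Lemma mean_zero_periodic_step a b phi :
  mean_zero_periodic phi -> mean_zero_periodic (step a b phi).
Proof.
move=> [phiD phi0]; split=> [s|]; first by rewrite /step -addSn !phiD.
rewrite /step big_split /= -!mulr_sumr (periodic_sum_shift phiD) phi0.
by rewrite !mulr0 addr0.
Qed.

Lemma energy_ge0 phi : 0 <= energy D phi.
Proof. by apply: sumr_ge0 => s _; apply: sqr_ge0. Qed.

Lemma energy_shift phi : mean_zero_periodic phi ->
  \sum_(s < D) phi s.+1 ^+ 2 = energy D phi.
Proof.
by case=> phiD _; rewrite (@periodic_sum_shift (fun s => phi s ^+ 2)) // => s; rewrite phiD.
Qed.

(** Cauchy-Schwarz with weights [|a|] and [|b|] at each point, followed by shift invariance of the
    energy. *)
Lemma energy_step_le a b c phi : mean_zero_periodic phi ->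
  `|a| + `|b| <= c -> energy D (step a b phi) <= c ^+ 2 * energy D phi.
Proof.
move=> phi_per abc.
have c0 : 0 <= `|a| + `|b| by apply: addr_ge0.
apply: (@le_trans _ _ ((`|a| + `|b|) ^+ 2 * energy D phi)); last first.
  by apply: ler_wpM2r; rewrite ?energy_ge0 // ler_pXn2r ?nnegrE // (le_trans c0).
have -> : (`|a| + `|b|) ^+ 2 * energy D phi =
    \sum_(s < D) (`|a| + `|b|) * (`|a| * phi s ^+ 2 + `|b| * phi s.+1 ^+ 2).
  rewrite -mulr_sumr big_split /= -!mulr_sumr energy_shift // /energy.
  by ring.
apply: ler_sum => s _; rewrite /step.
rewrite -[X in X <= _]real_normK ?num_real //.
have := ler_normD (a * phi s) (b * phi s.+1); rewrite !normrM.
rewrite -[phi s ^+ 2]real_normK ?num_real // -[phi s.+1 ^+ 2]real_normK ?num_real //.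
set x := `|phi s|; set y := `|phi s.+1|; move=> le_n.
apply: (@le_trans _ _ ((`|a| * x + `|b| * y) ^+ 2)).
  by rewrite ler_pXn2r ?nnegrE // addr_ge0 ?mulr_ge0 ?normr_ge0.
rewrite -subr_ge0.
have -> : (`|a| + `|b|) * (`|a| * x ^+ 2 + `|b| * y ^+ 2) - (`|a| * x + `|b| * y) ^+ 2 =
   `|a| * `|b| * (x - y) ^+ 2 by ring.
by rewrite mulr_ge0 ?sqr_ge0 // mulr_ge0 ?normr_ge0.
Qed.

Lemma sqr_sum_le m (a : nat -> R) :
  (\sum_(s < m) a s) ^+ 2 <= m%:R * \sum_(s < m) a s ^+ 2.
Proof.
have -> : m%:R * \sum_(s < m) a s ^+ 2 =
    \sum_(s < m) \sum_(t < m) (a s ^+ 2 + a t ^+ 2) / 2.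
  rewrite [RHS](eq_bigr (fun s : 'I_m => (m%:R * a s ^+ 2 + \sum_(t < m) a t ^+ 2) / 2)).
    by rewrite -mulr_suml big_split /= -mulr_sumr sumr_const card_ord -mulr_natl; field.
  by move=> s _; rewrite -mulr_suml big_split /= sumr_const card_ord mulr_natl.
rewrite expr2 mulr_suml; apply: ler_sum => s _; rewrite mulr_sumr.
apply: ler_sum => t _; have := sqr_ge0 (a s - a t); lra.
Qed.

(** All values lie within the total variation [L] of [phi 0]. The mean being zero, [|phi 0| <= L],
    so every value is at most [2 * L] in size; Cauchy-Schwarz bounds [L ^+ 2] by the sum of squared
    increments. *)
Lemma poincare phi : mean_zero_periodic phi ->
  energy D phi <= 4 * D%:R ^+ 2 * \sum_(s < D) (phi s - phi s.+1) ^+ 2.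
Proof.
move=> [_ phi0]; have [->|D0] := posnP D; first by rewrite /energy !big_ord0 mulr0.
have D0R : 0 < D%:R :> R by rewrite ltr0n.
pose L := \sum_(s < D) `|phi s - phi s.+1|.
have dist0 s : (s <= D)%N -> `|phi s - phi 0%N| <= L.
  move=> sD; rewrite /L -(big_mkord xpredT (fun s => `|phi s - phi s.+1|)).
  rewrite (big_cat_nat (leq0n s) sD) //= -[X in X <= _]addr0 lerD ?sumr_ge0 //.
  elim: s sD => [|s IHs] sD; first by rewrite subrr normr0 big_geq.
  rewrite big_nat_recr //= (_ : _ - _ = (phi s - phi 0%N) - (phi s - phi s.+1)); last by ring.
  by apply: le_trans (ler_normB _ _) _; rewrite lerD2r IHs // ltnW.
have L0 : 0 <= L by apply: sumr_ge0.
have phi0L : `|phi 0%N| <= L.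
  rewrite -(ler_pM2l D0R) -{1}(gtr0_norm D0R) -normrM.
  have -> : D%:R * phi 0%N = - \sum_(s < D) (phi s - phi 0%N).
    by rewrite sumrB phi0 sumr_const card_ord -mulr_natl; ring.
  rewrite normrN; apply: le_trans (ler_norm_sum _ _ _) _.
  rewrite mulr_natl -[D in L *+ D]card_ord -sumr_const.
  by apply: ler_sum => s _; apply/dist0/ltnW.
have phiL s : (s < D)%N -> phi s ^+ 2 <= 4 * L ^+ 2.
  move=> /ltnW/dist0 sL; rewrite -[_ ^+ 2]real_normK ?num_real //.
  have -> : 4 * L ^+ 2 = (2 * L) ^+ 2 by ring.
  rewrite ler_pXn2r ?nnegrE ?mulr_ge0 //.
  have := ler_normD (phi s - phi 0%N) (phi 0%N); rewrite subrK.
  by move: sL phi0L; lra.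
have LL : L ^+ 2 <= D%:R * \sum_(s < D) (phi s - phi s.+1) ^+ 2.
  apply: le_trans (sqr_sum_le D (fun s => `|phi s - phi s.+1|)) _.
  by under eq_bigr do rewrite real_normK ?num_real //.
have : energy D phi <= D%:R * (4 * L ^+ 2).
  rewrite mulr_natl -[D in _ *+ D]card_ord -sumr_const.
  by apply: ler_sum => s _; apply: phiL.
move=> h; apply: le_trans h _.
by rewrite expr2 -!mulrA [X in _ <= X]mulrCA ler_pM2l // ler_pM2l.
Qed.

(** Sum the identity [(a x + b y)^2 = (a + b) (a x^2 + b y^2) - a b (x - y)^2] over a period and
    apply [poincare] to the last term. *)
Lemma energy_step_contract a b phi : (0 < D)%N -> mean_zero_periodic phi ->
  0 <= a -> 0 <= b ->
  energy D (step a b phi) <=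
    ((a + b) ^+ 2 - a * b / (4 * D%:R ^+ 2)) * energy D phi.
Proof.
move=> D0 phi_per a0 b0.
have -> : energy D (step a b phi) =
    (a + b) ^+ 2 * energy D phi - a * b * \sum_(s < D) (phi s - phi s.+1) ^+ 2.
  rewrite /energy (_ : (a + b) ^+ 2 * _ = (a + b) * (a * energy D phi + b * energy D phi)).
    rewrite -{2}(energy_shift phi_per) /energy !mulr_sumr -big_split mulr_sumr -sumrB.
    by apply: eq_bigr => s _; rewrite /step /=; ring.
  by rewrite /energy; ring.
rewrite mulrBl lerD2l lerN2 -[_ * energy _ _]mulrA; apply: ler_wpM2l; first exact: mulr_ge0.
rewrite ler_pdivrMl ?poincare //.
by rewrite mulr_gt0 // exprn_gt0 // ltr0n.
Qed.

Lemma energy_foldl (I : eqType) (r : seq I) (a b c : I -> R) phi :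
  mean_zero_periodic phi ->
  (forall i ph, mean_zero_periodic ph ->
     energy D (step (a i) (b i) ph) <= c i ^+ 2 * energy D ph) ->
  energy D (foldl (fun ph i => step (a i) (b i) ph) phi r) <=
    (\prod_(i <- r) c i) ^+ 2 * energy D phi.
Proof.
move=> phi_per abc; elim: r phi phi_per => [|i r IHr] phi phi_per /=.
  by rewrite big_nil expr1n mul1r.
apply: le_trans (IHr _ (mean_zero_periodic_step _ _ phi_per)) _.
rewrite big_cons exprMn [X in _ <= X]mulrAC [X in X <= _]mulrC.
by apply: ler_wpM2r; rewrite ?sqr_ge0 ?abc.
Qed.

End Energy.

(** The centred indicator [psi] of a residue class has mean zero, and the difference to be bounded
    is the value at 0 of the function obtained from [psi] by one step per row. A row outside [J] has
    the positive weights [#|X| - #|P|] and [#|P|], so it contracts the energy; a row in [J] costs at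
    most the factor [#|X| ^ 2]. *)
Lemma count_mod_mixing (X : finType) (P : pred X) (D : nat) :
  (0 < D)%N -> (0 < #|P| < #|X|)%N ->
  exists2 l : R, 0 < l < 1 & forall n (F : 'I_n -> X -> R) (J : {set 'I_n}) m,
    (forall i x, `|F i x| <= 1) -> (forall i x, i \notin J -> F i x = 1) ->
    `|\sum_(w : {ffun 'I_n -> X}) (\prod_i F i (w i)) *
         ((\sum_i P (w i))%N == m %[mod D])%:R
      - D%:R^-1 * \sum_(w : {ffun 'I_n -> X}) \prod_i F i (w i)| <=
    #|X|%:R ^+ n * l ^+ (n - #|J|).
Proof.
move=> D0 /andP[P0 PX].
pose B : R := #|X|%:R; pose b : R := #|P|%:R; pose a : R := B - b.
have b0 : 0 < b by rewrite ltr0n.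
have a0 : 0 < a by rewrite subr_gt0 ltr_nat.
have B0 : 0 < B by rewrite -(subrK b B) addr_gt0.
have DR : 1 <= D%:R :> R by rewrite ler1n.
have D2 : 0 < 8 * B ^+ 2 * D%:R ^+ 2 
  by rewrite mulr_gt0 ?mulr_gt0 ?exprn_gt0 // (lt_le_trans ltr01).
(* With this [e] the factor in [energy_step_contract] is [B ^+ 2 * (1 - 2 * e)], which is at most
   [(B * (1 - e)) ^+ 2]. *)
pose e := a * b / (8 * B ^+ 2 * D%:R ^+ 2).
have e0 : 0 < e by rewrite divr_gt0 // mulr_gt0.
have e1 : e < 1.
  rewrite ltr_pdivrMr // mul1r; apply: (@lt_le_trans _ _ (8 * B ^+ 2)).
    have -> : B = a + b by rewrite subrK.
    rewrite -subr_gt0 (_ : _ - _ = 8 * a ^+ 2 + 15 * (a * b) + 8 * b ^+ 2); last by ring.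
    by rewrite !addr_gt0 ?mulr_gt0 ?exprn_gt0.
  by rewrite ler_peMr ?mulr_ge0 ?sqr_ge0 // exprn_ege1.
exists (1 - e); first by lra.
move=> n F J m F1 FJ.
pose psi s : R := (s == m %[mod D])%:R - D%:R^-1.
have psi_per : mean_zero_periodic D psi.
  split=> [s|]; first by rewrite /psi modnDr.
  rewrite sumrB sumr_const card_ord -(mulr_natl D%:R^-1) divff ?gt_eqF ?ltr0n //.
  pose m0 := Ordinal (ltn_pmod m D0).
  rewrite (bigD1 m0) //= modn_mod eqxx big1 ?addr0 ?subrr // => s sm.
  rewrite modn_small // (_ : (_ == _) = false) //.
  by apply: contraNF sm => /eqP sm; apply/eqP/val_inj.
have psi_energy : energy D psi <= 1.
  have -> : energy D psi = \sum_(s < D) ((1 - 2 * D%:R^-1) * psi s + (D%:R^-1 - D%:R^-1 ^+ 2)).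
    by apply: eq_bigr => s _; rewrite /psi; case: eqP => _ /=; ring.
  rewrite big_split /= -mulr_sumr psi_per.2 sumr_const card_ord mulr0 add0r -[X in X <= _]mulr_natl.
  rewrite mulrBr expr2 mulrA divff ?gt_eqF ?ltr0n // mul1r.
  by rewrite gerBl invr_ge0 ler0n.
have -> : \sum_(w : {ffun 'I_n -> X}) (\prod_i F i (w i)) *
         ((\sum_i P (w i))%N == m %[mod D])%:R
      - D%:R^-1 * \sum_(w : {ffun 'I_n -> X}) \prod_i F i (w i) =
    \sum_(w : {ffun 'I_n -> X}) (\prod_i F i (w i)) * psi (\sum_i P (w i))%N.
  by rewrite mulr_sumr -sumrB; apply: eq_bigr => w _; rewrite /psi; ring.
rewrite sum_ffun_step; set phi := foldl _ _ _.
pose c i := B * (if i \in J then 1 else 1 - e).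
have : energy D phi <= (\prod_(i <- index_enum 'I_n) c i) ^+ 2 * energy D psi.
  apply: energy_foldl => // i ph ph_per; rewrite /c.
  case: ifPn => iJ.
    apply: energy_step_le => //; rewrite mulr1.
    apply: (@le_trans _ _ (\sum_(x | ~~ P x) 1 + \sum_(x | P x) 1)).
      by apply: lerD; apply: le_trans (ler_norm_sum _ _ _) _; apply: ler_sum => x _.
    by rewrite addrC -(bigID P xpredT) /= sumr_const.
  have -> : \sum_(x | ~~ P x) F i x = a.
    rewrite (eq_bigr (fun _ => 1)) => [|x _]; last exact: FJ.
    by rewrite /a /B /b -(cardC P) natrD addrAC subrr add0r sumr_const.
  have -> : \sum_(x | P x) F i x = b.
    rewrite (eq_bigr (fun _ => 1)) => [|x _]; last exact: FJ.
    by rewrite sumr_const.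
  apply: le_trans (energy_step_contract D0 ph_per (ltW a0) (ltW b0)) _.
  apply: ler_wpM2r; first exact: energy_ge0.
  rewrite subrK exprMn.
  have -> : a * b / (4 * D%:R ^+ 2) = B ^+ 2 * (2 * e).
    have Bn : B != 0 by rewrite gt_eqF.
    have Dn : D%:R != 0 :> R by rewrite pnatr_eq0 -lt0n.
    by rewrite /e; field; rewrite ?Bn ?Dn.
  rewrite -[X in X - _]mulr1 -mulrBr ler_pM2l ?exprn_gt0 //.
  by have := sqr_ge0 e; nra.
have -> : \prod_(i <- index_enum 'I_n) c i = B ^+ n * (1 - e) ^+ (n - #|J|).
  rewrite big_split /= prodr_const card_ord; congr (_ * _).
  rewrite (eq_bigr (fun i => if i \in ~: J then 1 - e else 1)).
    by rewrite -big_mkcond prodr_const cardsCs setCK card_ord.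
  by move=> i _; rewrite inE; case: (i \in J).
set K := B ^+ n * _ => phiK.
have K0 : 0 <= K.
  by apply: mulr_ge0; apply: exprn_ge0; rewrite ltW // subr_gt0.
rewrite -(@ler_pXn2r _ 2) ?nnegrE // real_normK ?num_real //.
apply: (@le_trans _ _ (energy D phi)).
  rewrite /energy (bigD1 (Ordinal D0)) //= lerDl sumr_ge0 // => s _.
  exact: sqr_ge0.
by apply: le_trans phiK _; rewrite ler_piMr ?sqr_ge0.
Qed.

End CyclicMixing.

(** * Exponential estimates and a count of small sets *)

Section Tails.
Variable R : realType.

Lemma bernoulli_inequality (x : R) n : -1 <= x -> 1 + n%:R * x <= (1 + x) ^+ n.
Proof.
move=> x1; elim: n => [|n IHn]; first by rewrite mul0r addr0 expr0.
have x1' : 0 <= 1 + x by lra.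
rewrite exprS; apply: le_trans (ler_wpM2l x1' IHn); rewrite -natr1.
have := mulr_ge0 (ler0n R n) (sqr_ge0 x); nra.
Qed.

(** Take [N = t * d.+1]. Bernoulli gives [l ^- t >= t * a], hence [l ^- N >= (t * a) ^+ d.+1], which
    has one more power of [t] than [N ^ d]; [c] is the resulting threshold for [t]. *)
Lemma exponential_beats_polynomial (l A : R) d N0 : 0 < l < 1 -> 0 < A ->
  exists2 N, (N0 < N)%N & A * N%:R ^+ d * l ^+ N <= 1.
Proof.
move=> /andP[l0 l1] A0; pose a := l^-1 - 1.
have a0 : 0 < a by rewrite subr_gt0 invf_gt1.
pose c := A * d.+1%:R ^+ d / a ^+ d.+1.
pose t := (maxn (Num.trunc c).+1 N0.+1).
have ct : c <= t%:R.
  apply: ltW; apply: lt_le_trans (truncnS_gt c) _.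
  by rewrite ler_nat leq_maxl.
have t0 : 0 < t%:R :> R by rewrite ltr0n leq_max.
exists (t * d.+1)%N.
  by apply: (@leq_trans t); rewrite ?leq_maxr // leq_pmulr.
have lN : (t%:R * a) ^+ d.+1 <= l ^- (t * d.+1).
  have lt0 : 0 < l ^- t by rewrite invr_gt0 exprn_gt0.
  rewrite exprM -exprVn ler_pXn2r ?nnegrE ?(ltW lt0) ?(ltW (mulr_gt0 t0 a0)) //.
  apply: (@le_trans _ _ (1 + t%:R * a)); first by rewrite lerDr.
  have -> : (l ^+ t)^-1 = (1 + a) ^+ t by rewrite /a addrC subrK exprVn.
  by apply: bernoulli_inequality; lra.
rewrite -ler_pdivlMr ?exprn_gt0 // div1r; apply: (le_trans _ lN).
rewrite natrM exprMn mulrCA [X in _ <= X]exprMn [t%:R ^+ d.+1]exprSr -[X in _ <= X]mulrA.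
rewrite ler_pM2l ?exprn_gt0 //.
by rewrite -ler_pdivrMr ?exprn_gt0.
Qed.

(** A Chernoff bound: the mean number of occurrences of [x] is [q * n1], and each occurrence is
    given the weight [1 - h] with [h = 1 / q]. That [l < 1] comes from [u ^+ #|X| <= (1 + h)^-1] and
    from [(1 + h) ^+ q * (1 - h) ^+ q.-1 >= 1 + h ^+ 3]. *)
Lemma lower_tail (X : finType) q : (1 < q)%N -> (0 < #|X|)%N ->
  exists2 l : R, 0 < l < 1 & forall n n1 (x : X), n = (q * #|X| * n1)%N ->
    #|[set w : {ffun 'I_n -> X} | (#|[set i | w i == x]| < q.-1 * n1)%N]|%:R <=
    #|X|%:R ^+ n * l ^+ n1.
Proof.
move=> q1 X0; pose B : R := #|X|%:R; pose h : R := q%:R^-1.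
have B0 : 0 < B by rewrite ltr0n.
have B1 : 1 <= B by rewrite ler1n.
have q0 : 0 < q%:R :> R by rewrite ltr0n ltnW.
have q2 : 2 <= q%:R :> R by rewrite ler_nat.
have qh : q%:R * h = 1 by rewrite divff ?gt_eqF.
have h0 : 0 < h by rewrite invr_gt0.
have h1 : h < 1 by rewrite invf_lt1 //; lra.
pose u := 1 - h / B.
have hB : h / B <= h by rewrite ler_pdivrMr // ler_peMr // ltW.
have hB0 : 0 < h / B by rewrite divr_gt0.
have u0 : 0 < u by rewrite /u; lra.
pose l := u ^+ (q * #|X|) / (1 - h) ^+ q.-1.
have h10 : 0 < 1 - h by lra.
have uB : u ^+ #|X| * (1 + h) <= 1.
  apply: (@le_trans _ _ (u ^+ #|X| * (1 + h / B) ^+ #|X|)).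
    apply: ler_wpM2l; first by rewrite exprn_ge0 // ltW.
    have -> : 1 + h = 1 + #|X|%:R * (h / B) by rewrite mulrCA divff ?gt_eqF // mulr1.
    by apply: bernoulli_inequality; lra.
  rewrite -exprMn exprn_ile1 ?mulr_ge0 //; rewrite /u; try lra.
  by have := sqr_ge0 (h / B); nra.
have pos1 : 0 < (1 + h) * (1 - h ^+ 2) ^+ q.-1.
  have : 0 < (1 - h) * (1 + h) by rewrite mulr_gt0 //; lra.
  rewrite (_ : _ * _ = 1 - h ^+ 2); last by ring.
  by move=> ?; rewrite mulr_gt0 ?exprn_gt0 //; lra.
have big : 1 < (1 + h) ^+ q * (1 - h) ^+ q.-1.
  have -> : (1 + h) ^+ q * (1 - h) ^+ q.-1 = (1 + h) * (1 - h ^+ 2) ^+ q.-1.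
    rewrite -{1}(prednK (ltnW q1)) exprS -mulrA -exprMn; congr (_ * _ ^+ _); ring.
  have hh : - 1 <= - h ^+ 2 by rewrite lerN2 exprn_ile1 // ltW.
  apply: (@lt_le_trans _ _ ((1 + h) * (1 + q.-1%:R * - h ^+ 2))).
    have -> : q.-1%:R = q%:R - 1 :> R by rewrite -[in RHS](prednK (ltnW q1)) -natr1 addrK.
    have -> : (1 + h) * (1 + (q%:R - 1) * - h ^+ 2) =
      1 + h ^+ 3 + (1 - q%:R * h) * (h + h ^+ 2) by ring.
    by rewrite qh subrr mul0r addr0 ltrDl exprn_gt0.
  by rewrite ler_pM2l ?bernoulli_inequality //; lra.
have l0 : 0 < l by rewrite divr_gt0 // exprn_gt0.
exists l.
  rewrite l0 /= ltr_pdivrMr ?exprn_gt0 // mul1r.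
  have p1 : 0 < (1 + h) ^+ q by apply: exprn_gt0; lra.
  rewrite -(ltr_pM2l p1); apply: (le_lt_trans _ big).
  rewrite mulnC exprM -exprMn [(1 + h) * _]mulrC; apply: exprn_ile1 => //.
  by apply: mulr_ge0; [rewrite exprn_ge0 // ltW | lra].
move=> n n1 x n_def; set bad := [set w | _].
pose g x' : R := if x' == x then 1 - h else 1.
have g0 x' : 0 < g x' by rewrite /g; case: ifP; rewrite ?ltr01.
have sum_g : \sum_x' g x' = B * u.
  rewrite (bigD1 x) //= {1}/g eqxx (eq_bigr (fun _ => 1)) => [|x' /negbTE]; last first.
    by rewrite /g => ->.
  rewrite sumr_const cardC1 /u mulrBr mulrCA divff ?gt_eqF // /B -(prednK X0) -natr1 /=.
  by ring.
have prod_g : \sum_(w : {ffun 'I_n -> X}) \prod_i g (w i) = (B * u) ^+ n.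
  by rewrite -(bigA_distr_bigA (fun (_ : 'I_n) x' => g x')) prodr_const card_ord sum_g.
(* Markov's inequality for the product weight: a bad [w] has fewer than [q.-1 * n1] factors
   [1 - h]. *)
have bad_g : #|bad|%:R * (1 - h) ^+ (q.-1 * n1) <= (B * u) ^+ n.
  rewrite -prod_g mulr_natl -sumr_const big_mkcond /=; apply: ler_sum => w _.
  case: ifP => [|_]; last by apply: prodr_ge0 => i _; rewrite ltW.
  rewrite inE => hw; have -> : \prod_i g (w i) = (1 - h) ^+ #|[set i | w i == x]|.
    rewrite -prodr_const [RHS]big_mkcond; apply: eq_bigr => i _ /=.
    by rewrite inE.
  apply: ler_wiXn2l; rewrite ?(ltnW hw) //; lra.
rewrite -(ler_pM2r (exprn_gt0 (q.-1 * n1) h10)); apply: le_trans bad_g _.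
rewrite exprMn -mulrA ler_pM2l ?exprn_gt0 // /l exprMn exprVn -!exprM n_def.
by rewrite divfK // gt_eqF // exprn_gt0.
Qed.

Lemma card_small_sets (I : finType) d :
  (#|[set T : {set I} | #|T| <= d]| <= #|I|.+1 ^ d)%N.
Proof.
elim: d => [|d IHd].
  rewrite expn0 -(cards1 (set0 : {set I})) subset_leq_card //.
  by apply/subsetP => T; rewrite !inE leqn0 cards_eq0.
(* Each set of at most [d.+1] elements arises from one of at most [d] elements by adding at most one
   point. *)
pose add (p : {set I} * option I) := if p.2 is Some x then x |: p.1 else p.1.
apply: (@leq_trans #|setX [set T : {set I} | (#|T| <= d)%N] [set: option I]|); last first.
  by rewrite cardsX cardsT card_option expnSr leq_mul2r IHd orbT.
apply: (leq_trans _ (leq_imset_card add _)); apply/subset_leq_card/subsetP => T.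
rewrite inE => Td; apply/imsetP.
have [T0|[x xT]] := set_0Vmem T.
  by exists (set0, None); rewrite ?T0 // !inE cards0.
exists (T :\ x, Some x); last by rewrite /add /= setD1K.
by rewrite !inE /=; move: Td; rewrite (cardsD1 x) xT add1n ltnS => ->.
Qed.

End Tails.

(** * Matrices as families of rows *)

Section RowMatrices.
Variables (R : realType) (n k : nat).

Definition mat_of_rows (w : 'I_n -> cube 'I_k) : cube ('I_n * 'I_k)%type :=
  [ffun p => w p.1 p.2].

Lemma mat_of_rowsK w i : row_of (mat_of_rows w) i = w i.
Proof. by apply/ffunP => a; rewrite !ffunE. Qed.

Lemma sum_rows (V : nmodType) (f : {ffun 'I_n -> cube 'I_k} -> V) :
  \sum_y f [ffun i => row_of y i] = \sum_w f w.
Proof.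
rewrite [RHS](reindex (fun y => [ffun i => row_of y i])) //=.
exists (fun w : {ffun 'I_n -> cube 'I_k} => mat_of_rows w) => [y _|w _].
  by apply/ffunP => -[i a]; rewrite !ffunE.
by apply/ffunP => i; rewrite ffunE mat_of_rowsK.
Qed.

Definition row_chi (T : {set 'I_n * 'I_k}) i (x : cube 'I_k) : R :=
  \prod_(a | (i, a) \in T) (-1) ^+ x a.

Lemma chi_rows (T : {set 'I_n * 'I_k}) (y : cube ('I_n * 'I_k)%type) :
  chi R T y = \prod_i row_chi T i (row_of y i).
Proof.
rewrite pair_big_dep; apply: eq_big => [[i a]|[i a] _] //=.
by rewrite ffunE.
Qed.

Lemma norm_row_chi (T : {set 'I_n * 'I_k}) i x : `|row_chi T i x| = 1.
Proof. by rewrite normr_prod big1 // => a _; rewrite normrX normrN1 expr1n. Qed.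

Lemma row_chi1 (T : {set 'I_n * 'I_k}) i x : i \notin [set p.1 | p in T] -> row_chi T i x = 1.
Proof.
move=> iT; rewrite /row_chi big_pred0 // => a.
by apply: contraNF iT => iaT; apply/imsetP; exists (i, a).
Qed.

End RowMatrices.

(** * A wise uniform distribution on balanced matrices *)

Section BalancedDesign.
Variable R : realType.

(** On the set [G] of admissible matrices the Gram matrix of the characters of degree at most [d] is
    close to [(2 ^ k) ^ n / D] times the identity, by [count_mod_mixing] and [lower_tail]. The error
    decays exponentially in [N], while the number of characters is polynomial in [N], so
    [exists_orthogonal_density] applies for a suitable [N]. *)
Lemma exists_balanced_wise_uniform k d (P : pred (cube 'I_k)) (D q M : nat) :
  (0 < D)%N -> (0 < #|P| < 2 ^ k)%N -> (1 < q)%N -> (0 < M)%N ->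
  exists2 N, (0 < N)%N & forall m n, n = (q * 2 ^ k * (M * N))%N ->
    exists Z : {ffun cube ('I_n * 'I_k)%type -> R},
    [/\ is_dist Z, wise_uniform d Z &
      forall y, Z y != 0 ->
        (forall x, (q.-1 * (M * N) <= #|[set i | row_of y i == x]|)%N) /\
        (\sum_i P (row_of y i) = m %[mod D])%N].
Proof.
move=> D0 PB q1 M0; pose X := cube 'I_k.
have XB : #|{: X}| = (2 ^ k)%N by rewrite card_cube card_ord.
have B0 : (0 < 2 ^ k)%N by rewrite expn_gt0.
pose B : R := (2 ^ k)%:R.
have BR : 0 < B by rewrite ltr0n.
have [|l1 /andP[l10 l11] mixing] := count_mod_mixing R (P := P) D0.
  by rewrite XB.
have [|l2 /andP[l20 l21] tail] := lower_tail R (X := X) q1; first by rewrite XB.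
pose l := Num.max l1 l2.
have l0 : 0 < l by rewrite lt_max l10.
have l1' : l < 1 by rewrite gt_max l11.
(* [c * N] is at least [n * k + 1], so [(c * N) ^ d] bounds the number of characters. [A] is chosen
   so that [A * N ^ d * l ^ N <= 1] implies the smallness condition [Jeta]. *)
pose c := ((q * 2 ^ k * M) * k + 1)%N.
pose A : R := 2 * D%:R * (1 + B) * c%:R ^+ d.
have DR : 0 < D%:R :> R by rewrite ltr0n.
have A0 : 0 < A.
  by rewrite !mulr_gt0 ?exprn_gt0 ?ltr0n ?addr_gt0 // /c addn1.
(* Requiring [N > 2 * d] ensures [n - 2 * d >= N], because [n >= 2 * N]. *)
have [|N Nd AN] := @exponential_beats_polynomial R l A d (2 * d)%N _ A0.
  by rewrite l0.
have N0 : (0 < N)%N by apply: leq_ltn_trans Nd.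
exists N => // m n n_def.
pose I := ('I_n * 'I_k)%type.
pose J := {T : {set I} | (#|T| <= d)%N}.
pose tl (y : cube I) x := (#|[set i | row_of y i == x]| < q.-1 * (M * N))%N.
pose md (y : cube I) := ((\sum_i P (row_of y i))%N == m %[mod D]).
pose G := [set y : cube I | [forall x, ~~ tl y x] && md y].
pose Bn := B ^+ n.
have Bn0 : 0 < Bn by apply: exprn_gt0.
have bad_le : #|[set y : cube I | [exists x, tl y x]]|%:R <= B * (Bn * l2 ^+ (M * N)).
  apply: (@le_trans _ _ (\sum_(x : X) #|[set y : cube I | tl y x]|%:R)).
    rewrite -natr_sum ler_nat -sum1_card.
    under [X in (_ <= X)%N]eq_bigr do rewrite -sum1_card.
    rewrite big_mkcond; under [X in (_ <= X)%N]eq_bigr do rewrite big_mkcond.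
    rewrite exchange_big leq_sum //= => y _; rewrite inE.
    by case: existsP => // -[x xy]; rewrite (bigD1 x) //= inE xy.
  rewrite /B -XB mulr_natl -sumr_const; apply: ler_sum => x _.
  have := tail n (M * N)%N x; rewrite XB => /(_ n_def) h; apply: (le_trans _ h).
  rewrite -!sum1_card !natr_sum big_mkcond [X in _ <= X]big_mkcond -[X in _ <= X]sum_rows.
  apply: ler_sum => y _; rewrite !inE /tl.
  rewrite (_ : [set i | [ffun i0 => row_of y i0] i == x] = [set i | row_of y i == x]) //.
  by apply/setP => i; rewrite !inE ffunE.
(* The first term is the mixing error, as a product of two characters involves at most [2 * d] rows;
   the second is a union bound over the rare values [x]. *)
pose eta := Bn * l1 ^+ (n - 2 * d) + B * (Bn * l2 ^+ (M * N)).
have gram (T T' : J) :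
    `|\sum_(y in G) chi R (val T) y * chi R (val T') y - Bn / D%:R * (T == T')%:R| <= eta.
  have -> : \sum_(y in G) chi R (val T) y * chi R (val T') y =
      \sum_y chi R (val T) y * chi R (val T') y * (md y)%:R -
      \sum_(y | [exists x, tl y x] && md y) chi R (val T) y * chi R (val T') y.
    rewrite [X in _ - X]big_mkcond [X in X = _]big_mkcond -sumrB; apply: eq_bigr => y _.
    rewrite inE -negb_exists; case: [exists x, tl y x]; case: (md y) => /=; ring.
  rewrite addrAC; apply: le_trans (ler_normB _ _) _; apply: lerD.
    pose F i x := row_chi R (val T) i x * row_chi R (val T') i x.
    have FE y : chi R (val T) y * chi R (val T') y = \prod_i F i (row_of y i).
      by rewrite !chi_rows -big_split.
    pose Jt := [set p.1 | p in val T :|: val T'].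
    have Jt2d : (#|Jt| <= 2 * d)%N.
      apply: leq_trans (leq_imset_card _ _) _; rewrite cardsU; apply: leq_trans (leq_subr _ _) _.
      by rewrite mul2n -addnn leq_add ?(valP T) ?(valP T').
    have F1 i x : `|F i x| <= 1 by rewrite normrM !norm_row_chi mulr1.
    have FJ i x : i \notin Jt -> F i x = 1.
      rewrite /Jt imsetU inE negb_or => /andP[iT iT'].
      by rewrite /F !row_chi1 // mulr1.
    have := mixing n F Jt m F1 FJ.
    rewrite -sum_rows -[in X in _ - _ * X]sum_rows XB -/B -/Bn => h.
    apply: (@le_trans _ _ (Bn * l1 ^+ (n - #|Jt|))); last first.
      by rewrite ler_pM2l // ler_wiXn2l ?ltW // leq_sub2l.
    apply: (le_trans _ h); rewrite le_eqVlt; apply/orP; left; apply/eqP; congr (`|_ - _|).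
      apply: eq_bigr => y _; rewrite FE; congr (_ * _).
        by apply: eq_bigr => i _; rewrite ffunE.
      by rewrite /md; under [in RHS]eq_bigr do rewrite ffunE.
    rewrite mulrAC [LHS]mulrC; congr (_ * _).
    transitivity (\sum_y chi R (val T) y * chi R (val T') y).
      rewrite chi_orthogonal (inj_eq val_inj) card_prod !card_ord; congr (_ * _).
      by rewrite /Bn /B -natrX -expnM mulnC.
    by apply: eq_bigr => y _; rewrite FE; apply: eq_bigr => i _; rewrite ffunE.
  apply: (le_trans _ bad_le); apply: le_trans (ler_norm_sum _ _ _) _.
  rewrite -sum1_card natr_sum big_mkcond [X in _ <= X]big_mkcond; apply: ler_sum => y _.
  rewrite inE; case: [exists x, tl y x]; case: (md y) => //=.
  by rewrite normrM !norm_chi mulr1.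
have J0 : (#|(set0 : {set I})| <= d)%N by rewrite cards0.
pose j0 : J := exist _ set0 J0.
have Jeta : #|{: J}|%:R * eta <= Bn / D%:R / 2.
  have cJ : #|{: J}|%:R <= (c * N)%:R ^+ d :> R.
    rewrite -natrX ler_nat card_sig.
    apply: (@leq_trans (#|{: I}|.+1 ^ d)).
      by apply: (leq_trans _ (card_small_sets _ d)); rewrite cardsE.
    have [->|d0] := posnP d; first by rewrite !expn0.
    rewrite leq_exp2r // card_prod !card_ord n_def /c.
    by rewrite mulnDl mul1n -addn1 leq_add // mulnA [X in (_ <= X)%N]mulnAC.
  have eta_le : eta <= Bn * ((1 + B) * l ^+ N).
    rewrite /eta mulrCA -mulrDr ler_pM2l // mulrDl mul1r lerD //.
      apply: (@le_trans _ _ (l1 ^+ N)).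
        have n2 : (2 * N <= n)%N.
          rewrite n_def leq_mul ?leq_pmull //.
          by apply: leq_trans q1 (leq_pmulr _ B0).
        by rewrite ler_wiXn2l ?ltW //; move: Nd n2; clear; lia.
      by rewrite lerXn2r ?nnegrE ?(ltW l10) ?(ltW l0) // le_max lexx.
    rewrite ler_pM2l //; apply: (@le_trans _ _ (l2 ^+ N)).
      by rewrite ler_wiXn2l ?ltW // leq_pmull.
    by rewrite lerXn2r ?nnegrE ?(ltW l20) ?(ltW l0) // le_max lexx orbT.
  apply: le_trans (ler_pM _ _ cJ eta_le) _ => //.
    by rewrite addr_ge0 ?mulr_ge0 ?exprn_ge0 ?ltW.
  rewrite -[Bn / _ / _]mulrA mulrCA ler_pM2l //.
  rewrite -invfM -[X in _ <= X]div1r ler_pdivlMr ?mulr_gt0 //; apply: (le_trans _ AN).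
  rewrite /A natrM exprMn le_eqVlt; apply/orP; left; apply/eqP; ring.
have [|y T||Z [Z0 ZG Zchi]] := exists_orthogonal_density
    (f := fun (T : J) y => chi R (val T) y) (j0 := j0) _ _ _ gram Jeta.
- by move=> y; rewrite chi0.
- by rewrite norm_chi.
- exact: divr_gt0.
exists Z; split=> [||y /ZG].
- split=> //; transitivity (\sum_y Z y * chi R (val j0) y); last by rewrite Zchi eqxx.
  by apply: eq_bigr => y _; rewrite chi0 mulr1.
- apply: wise_uniform_chi => T Td; exact: (Zchi (exist _ T Td)).
- rewrite inE => /andP[/forallP ytl /eqP ymd]; split=> // x.
  by have := ytl x; rewrite /tl -leqNgt.
Qed.

End BalancedDesign.

(** * Histograms of rows *)

Section Histograms.

Lemma exists_fun_histogram (X : finType) n (h : X -> nat) : (\sum_x h x)%N = n ->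
  exists w : {ffun 'I_n -> X}, forall x, #|[set i | w i == x]| = h x.
Proof.
move=> hn; pose s := flatten [seq nseq (h x) x | x <- enum X].
have s_n : size s == n.
  rewrite size_flatten /shape -map_comp sumnE big_map big_enum /= -hn.
  by apply/eqP/eq_bigr => x _; rewrite /= size_nseq.
exists [ffun i => tnth (Tuple s_n) i] => x.
rewrite -sum1_card (eq_bigl (fun i => tnth (Tuple s_n) i == x)); last first.
  by move=> i; rewrite inE ffunE.
rewrite -(big_tuple _ _ (Tuple s_n) (pred1 x) (fun _ => 1%N)) sum1_count /=.
rewrite count_flatten -map_comp sumnE big_map big_enum /= (bigD1 x) //=.
rewrite count_nseq /= eqxx mul1n big1 ?addn0 // => x' /negbTE x'x.
by rewrite /= count_nseq /= x'x mul0n.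
Qed.

Lemma sum_histogram (V : nmodType) (X : finType) n (w : 'I_n -> X) (f : X -> V) :
  \sum_i f (w i) = \sum_x f x *+ #|[set i | w i == x]|.
Proof.
rewrite (partition_big w predT) //=; apply: eq_bigr => x _.
rewrite (eq_bigr (fun _ => f x)) => [|i /eqP-> //].
by rewrite -sumr_const; apply: eq_bigl => i; rewrite inE.
Qed.

Lemma sum_nat_histogram (X : finType) n (w : 'I_n -> X) (f : X -> nat) :
  (\sum_i f (w i) = \sum_x f x * #|[set i | w i == x]|)%N.
Proof.
rewrite (partition_big w predT) //=; apply: eq_bigr => x _.
rewrite (eq_bigr (fun _ => f x)) => [|i /eqP-> //].
by rewrite mulnC -sum_nat_const; apply: eq_bigl => i; rewrite inE.
Qed.

Lemma sum_count_mem (X : finType) (S : seq X) (P : pred X) :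
  (\sum_x P x * count_mem x S)%N = count P S.
Proof.
elim: S => [|s S IHS] /=; first by rewrite big1 // => x _; rewrite muln0.
under eq_bigr do rewrite mulnDr.
rewrite big_split /= IHS (bigD1 s) //= eqxx muln1 big1 ?addn0 // => x.
by rewrite eq_sym => /negbTE->; rewrite muln0.
Qed.

End Histograms.

(** * Moments of a multiset *)

Section Multisets.
Variables (R : realType) (k : nat).
Implicit Types (S : seq (cube 'I_k)) (P : cube 'I_k -> bool).

Lemma expect_multiset S P :
  expect (unif_multiset R S) P = (count P S)%:R / (size S)%:R.
Proof.
rewrite /expect -sum_count_mem natr_sum mulr_suml; apply: eq_bigr => x _.
by rewrite ffunE natrM mulrC mulrA.
Qed.

Lemma expect_unif P : expect (unif R (cube 'I_k)) P = #|P|%:R / (2 ^ k)%:R.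
Proof.
rewrite /expect; under eq_bigr do rewrite ffunE card_cube card_ord.
rewrite -mulr_sumr mulrC -natr_sum -sum1_card [in RHS]big_mkcond.
by congr (_%:R / _); apply: eq_bigr => x _; rewrite unfold_in; case: (P x).
Qed.

(** Orthogonality of [2 ^ k * count_mem x S - size S] to low-degree functions: the moments under the
    multiset and under the uniform law agree, and both denominators are cleared. *)
Lemma unif_multiset_low_degree d S (A : {set 'I_k}) g : (0 < size S)%N ->
  (d <= k)%N -> wise_uniform d (unif_multiset R S) ->
  (#|A| <= d)%N -> depends_on A g ->
  (2 ^ k)%:R * (\sum_x (count_mem x S)%:R * g x) = (size S)%:R * \sum_x g x :> R.
Proof.
move=> S0 dk Sd Ad gA.
have := wise_uniform_low_degree _ Sd (@wise_uniform_unif R _ d) Ad gA.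
rewrite card_ord => /(_ dk).
under eq_bigr do rewrite ffunE mulrAC.
under [X in _ = X -> _]eq_bigr do rewrite ffunE card_cube card_ord mulrC.
rewrite -!mulr_suml => E.
have S0R : (size S)%:R != 0 :> R by rewrite pnatr_eq0 -lt0n.
have k0R : (2 ^ k)%:R != 0 :> R by rewrite pnatr_eq0 expn_eq0.
move/(congr1 (fun x => x * (size S)%:R * (2 ^ k)%:R)): E.
by rewrite divfK // mulrAC divfK // mulrC => ->; rewrite mulrC.
Qed.

End Multisets.

(** * Distributions with an exact number of satisfying rows *)

Section ExactCount.
Variables (R : realType) (k d : nat).

Definition exact_count (P : cube 'I_k -> bool) n m :=
  exists theta : {ffun cube ('I_n * 'I_k)%type -> R},
    [/\ is_dist theta, wise_uniform d theta &
     forall y, theta y != 0 -> #|[set i | P (row_of y i)]| = m].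

Section Shuffle.
Variable n : nat.
Implicit Types (y : cube ('I_n * 'I_k)%type) (A : {set 'I_n * 'I_k}).

Definition shuffle (s : 'S_n) y := mat_of_rows (fun i => row_of y (s i)).

Lemma row_of_shuffle s y i : row_of (shuffle s y) i = row_of y (s i).
Proof. exact: mat_of_rowsK. Qed.

Definition row_agree A (z : cube ('I_n * 'I_k)%type) i (x : cube 'I_k) : R :=
  [forall a, ((i, a) \in A) ==> (x a == z (i, a))]%:R.

Lemma agree_rows A z y :
  (agree A z y)%:R = \prod_i row_agree A z i (row_of y i).
Proof.
have [/forall_inP yz|/forall_inPn[[i a] iaA yz]] := boolP (agree A z y).
  rewrite big1 // => i _; rewrite /row_agree (_ : [forall a, _] = true) //.
  by apply/forallP => a; apply/implyP => iaA; rewrite ffunE; apply: yz.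
rewrite (bigD1 i) //= {1}/row_agree (_ : [forall a, _] = false) ?mul0r //.
apply: contraNF yz => /forallP/(_ a); rewrite iaA ffunE.
by [].
Qed.

(** Transfers the permutation from the matrix to the event, whose set of entries keeps its
    cardinality. *)
Lemma agree_shuffle s A z y :
  agree A z (shuffle s y) =
  agree [set (s p.1, p.2) | p in A] (shuffle s^-1 z) y.
Proof.
apply/forall_inP/forall_inP => [yz _ /imsetP[[i a] iaA ->]|yz [i a] iaA].
  by have := yz _ iaA; rewrite !ffunE /= permK.
have := yz (s i, a); rewrite !ffunE /= permK; apply.
by apply/imsetP; exists (i, a).
Qed.

Lemma sum_card_rows A : (\sum_i #|[set a | (i, a) \in A]| = #|A|)%N.
Proof.
rewrite -[RHS]sum1_card; under eq_bigr do rewrite -sum1_card.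
rewrite pair_big_dep; apply: eq_bigl => -[i a] /=; by rewrite inE.
Qed.

(* Shuffling the rows uniformly makes the law depend on the histogram of the rows only,
   and bounded uniformity only on the low-degree moments of that histogram. *)
Lemma exact_count_of_histograms (P : cube 'I_k -> bool) m
    (Z : {ffun cube ('I_n * 'I_k)%type -> R}) (f : cube ('I_n * 'I_k)%type -> cube ('I_n * 'I_k)%type) :
  is_dist Z -> wise_uniform d Z ->
  (forall y, Z y != 0 -> #|[set i | P (row_of (f y) i)]| = m /\
     forall (A : {set 'I_k}) (g : cube 'I_k -> R), (#|A| <= d)%N -> depends_on A g ->
       \sum_i g (row_of (f y) i) = \sum_i g (row_of y i)) ->
  exact_count P n m.
Proof.
move=> [Z0 Z1] Zd fZ.
(* The law of [shuffle s (f y)] for [y] drawn from [Z] and an independent uniform [s]. *)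
pose theta : {ffun cube ('I_n * 'I_k)%type -> R} := [ffun y' =>
  n`!%:R^-1 * \sum_y \sum_(s : 'S_n) Z y * (y' == shuffle s (f y))%:R].
have n0 : n`!%:R != 0 :> R by rewrite pnatr_eq0 -lt0n fact_gt0.
have thetaE (g : cube ('I_n * 'I_k)%type -> R) : \sum_y' theta y' * g y' =
    n`!%:R^-1 * \sum_y Z y * \sum_(s : 'S_n) g (shuffle s (f y)).
  under eq_bigr do rewrite ffunE -mulrA mulr_suml.
  rewrite -mulr_sumr exchange_big /=; congr (_ * _); apply: eq_bigr => y _.
  under eq_bigr do rewrite mulr_suml.
  rewrite exchange_big mulr_sumr; apply: eq_bigr => s _.
  rewrite (bigD1 (shuffle s (f y))) //= eqxx mulr1 big1 ?addr0 // => y' /negbTE->.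
  by rewrite mulr0 mul0r.
exists theta; split.
- split=> [y'|].
    rewrite ffunE mulr_ge0 ?invr_ge0 ?ler0n // sumr_ge0 // => y _.
    by apply: sumr_ge0 => s _; rewrite mulr_ge0 ?ler0n.
  transitivity (\sum_y' theta y' * 1); first by apply: eq_bigr => y' _; rewrite mulr1.
  rewrite thetaE sumr_const -mulr_suml Z1 mul1r.
  by rewrite cardE -cardT card_Sn mulVf.
- apply/wise_uniformP => A z Ad.
  rewrite big_mkcond (eq_bigr (fun y' => theta y' * (agree A z y')%:R)); last first.
    by move=> y' _; case: agree; rewrite ?mulr1 ?mulr0.
  (* Averaged over [s], the event is a permanent of total degree [d], so [perm_sum_low_degree] lets
     [y] replace [f y]; then [wise_uniform d Z] applies for each fixed [s]. *)
  rewrite thetaE (eq_bigr (fun y => \sum_(s : 'S_n) Z y * (agree A z (shuffle s y))%:R)).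
    rewrite exchange_big /= (eq_bigr (fun _ => 2 ^- d)) => [|s _].
      by rewrite sumr_const -[X in _ * X]mulr_natl cardE -cardT card_Sn mulKf.
    rewrite -(iffLR (wise_uniformP d Z) Zd [set (s p.1, p.2) | p in A] (shuffle s^-1 z)).
      rewrite [RHS]big_mkcond; apply: eq_bigr => y _.
      by rewrite agree_shuffle; case: agree; rewrite ?mulr1 ?mulr0.
    by rewrite card_imset // => -[i a] [j b] [/perm_inj-> ->].
  move=> y _; rewrite -mulr_sumr; have [->|/fZ[_ fy]] := eqVneq (Z y) 0.
    by rewrite !mul0r.
  congr (_ * _); have E y' : \sum_(s : 'S_n) (agree A z (shuffle s y'))%:R =
      perm_sum (row_agree A z) (row_of y').
    apply: eq_bigr => s _; rewrite agree_rows; apply: eq_bigr => i _.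
    by rewrite row_of_shuffle.
  rewrite !E; apply: (perm_sum_low_degree (A := fun i => [set a | (i, a) \in A]) fy).
  + move=> i x x' xx'; rewrite /row_agree; congr (_%:R); congr nat_of_bool.
    apply: eq_forallb => a; case: (boolP ((i, a) \in A)) => //= iaA.
    by rewrite xx' // inE.
  + move=> i iA x; rewrite /row_agree (_ : [forall a, _] = true) //.
    apply/forallP => a; apply/implyP => iaA.
    have : a \in [set a | (i, a) \in A] by rewrite inE.
    by rewrite iA inE.
  + by rewrite sum_card_rows Ad.
- move=> y' y'0; have [y [s [Zy ->]]] : exists y s, Z y != 0 /\ y' = shuffle s (f y).
    apply: contrapT => H; move: y'0; rewrite ffunE big1 ?mulr0 ?eqxx // => y _.
    rewrite big1 // => s _; have [->|Zy] := eqVneq (Z y) 0; first by rewrite mul0r.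
    by case: eqP => [y'E|]; rewrite ?mulr0 //; case: H; exists y, s.
  rewrite -(fZ y Zy).1 -[RHS](card_imset _ (@perm_inj _ s^-1%g)).
  apply: eq_card => i; apply/idP/imsetP => [|[j + ->]]; rewrite !inE row_of_shuffle.
    by move=> Pi; exists (s i); rewrite ?inE ?permK.
  by rewrite permKV.
Qed.

End Shuffle.

(** With [e + p = 2 ^ k] and [Q = q.-1] the conclusion reads [n <= m + e * (Q * (M * N))] in the
    notation of the next proof. Once [Q * (e + p) * (M * N)] is cancelled it is [N] times the
    hypothesis. *)
Lemma threshold_arith Q M e p N D : (M * (e + p) <= Q * D ->
  Q.+1 * (e + p) * (M * N) <= Q * N * (D + p * M) + e * (Q * (M * N)))%N.
Proof.
move/leq_mul/(_ (leqnn N)) => h.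
rewrite (_ : _ * (M * N) = M * (e + p) * N + Q * (e + p) * (M * N))%N; last by ring.
rewrite (_ : _ + e * _ = Q * D * N + Q * (e + p) * (M * N))%N; last by ring.
by rewrite leq_add2r.
Qed.

(** The rate obtained is [(q - 1) / q] times [b / M]. The loss leaves room for the correction: every
    [x] occurs at least [q.-1 * M * N] times, so [j * M] occurrences can be removed as long as
    [j <= q.-1 * N]. *)
Lemma exists_exact_count (P : cube 'I_k -> bool) (S : seq (cube 'I_k)) q :
  (d <= k)%N -> wise_uniform d (unif_multiset R S) ->
  (#|P| * size S < count P S * 2 ^ k)%N -> (size S * 2 ^ k < q)%N ->
  exists n m, [/\ (0 < n)%N, exact_count P n m &
    (m * (q * size S) = q.-1 * count P S * n)%N].
Proof.
move=> dk Sd PS; set M := size S; set b := count P S; set B := (2 ^ k)%N => Mq.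
pose p := #|P|; have B0 : (0 < B)%N by rewrite expn_gt0.
have bM : (b <= M)%N by apply: count_size.
have M0 : (0 < M)%N.
  by rewrite lt0n; apply: contraTneq PS => /size0nil S0; rewrite /b S0 -leqNgt.
have p0 : (0 < p)%N.
  rewrite lt0n; apply: contraTneq PS => /eqP/pred0P P0; rewrite -leqNgt.
  by rewrite (eq_count P0) count_pred0 mul0n.
have pB : (p < B)%N.
  by rewrite ltnNge; apply: contraTN PS => Bp; rewrite -leqNgt mulnC leq_mul.
pose D := (b * B - p * M)%N; have D0 : (0 < D)%N by rewrite subn_gt0.
have DE : (D + p * M = b * B)%N by rewrite subnK // ltnW.
have q1 : (1 < q)%N by apply: leq_ltn_trans Mq; rewrite muln_gt0 M0.
have PB' : (0 < #|[pred x | P x]| < 2 ^ k)%N by rewrite p0.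
have [N N0 design] := exists_balanced_wise_uniform R d D0 PB' q1 M0.
(* Here [m = q.-1 * N * (p * M + D)]: the guaranteed number [p * (q.-1 * (M * N))] of satisfying
   rows plus [q.-1 * N] corrections of size [D]. *)
pose n := (q * B * (M * N))%N; pose m := (q.-1 * b * B * N)%N.
have [Z [Zdist Zd Zbal]] := design m n erefl.
have star (y : cube ('I_n * 'I_k)%type) : exists y' : cube ('I_n * 'I_k)%type, Z y != 0 ->
    #|[set i | P (row_of y' i)]| = m /\
    forall (A : {set 'I_k}) (g : cube 'I_k -> R), (#|A| <= d)%N -> depends_on A g ->
       \sum_i g (row_of y' i) = \sum_i g (row_of y i).
  have [_|/Zbal[hy]] := eqVneq (Z y) 0; first by exists y.
  pose h x := #|[set i : 'I_n | row_of y i == x]|.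
  set c := (\sum_i _)%N => cm.
  have cE : c = (\sum_(x | P x) h x)%N.
    rewrite /c (sum_nat_histogram (row_of y) (fun x => P x : nat)) [RHS]big_mkcond.
    by apply: eq_bigr => x _; rewrite /= -/(h x); case: (P x); rewrite ?mul1n.
  have nE : (\sum_x h x)%N = n.
    have := sum_nat_histogram (row_of y) (fun _ => 1%N).
    rewrite sum1_card card_ord => ->; apply: eq_bigr => x _; by rewrite mul1n.
  have c_ge : (p * (q.-1 * (M * N)) <= c)%N.
    by rewrite cE -sum_nat_const; apply: leq_sum => x _; apply: hy.
  have c_le : (c + (B - p) * (q.-1 * (M * N)) <= n)%N.
    rewrite -nE (bigID P) /= -cE leq_add2l.
    have -> : (B - p)%N = #|[predC P]| by rewrite /B -{1}(card_ord k) -card_cube -(cardC P) addKn.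
    by rewrite -sum_nat_const; apply: leq_sum => x _; apply: hy.
  have mE : m = (q.-1 * N * (D + p * M))%N by rewrite DE /m; ring.
  (* Corrections only increase the count. The values outside [P] also have their guaranteed
     occurrences, and [q > M * B] makes the remaining number of rows at most [m]. *)
  have cm_le : (c <= m)%N.
    have Mq' : (M * B <= q.-1)%N by rewrite -ltnS prednK // ltnW.
    have MBD : (M * B <= q.-1 * D)%N by apply: leq_trans Mq' (leq_pmulr _ D0).
    have nm : (n <= m + (B - p) * (q.-1 * (M * N)))%N.
      have : (M * ((B - p) + p) <= q.-1 * D)%N by rewrite subnK // ltnW.
      move/(threshold_arith N); rewrite subnK ?(ltnW pB) // prednK ?(ltnW q1) //.
      by rewrite mE.
    by rewrite -(leq_add2r ((B - p) * (q.-1 * (M * N)))) (leq_trans c_le).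
  have /dvdnP[j jE] : (D %| m - c)%N by rewrite -eqn_mod_dvd // cm.
  have cjm : (c + j * D = m)%N by rewrite -jE subnKC.
  have jq : (j <= q.-1 * N)%N.
    rewrite -(leq_pmul2r D0) -(leq_add2l c) cjm mE mulnDr addnC leq_add2r.
    by apply: leq_trans c_ge; rewrite leq_eqVlt; apply/orP; left; apply/eqP; ring.
  have jh x : (j * M <= h x)%N.
    apply: leq_trans (hy x).
    by rewrite [(M * N)%N]mulnC mulnA leq_mul2r jq orbT.
  (* The truncated subtraction is a true one by [jh]. The correction has total mass
     [j * (B * M - B * M) = 0] and mass [j * D] on [P]. *)
  pose h' x := (h x + j * B * count_mem x S - j * M)%N.
  have h'E x : (h' x + j * M = h x + j * B * count_mem x S)%N.
    by rewrite subnK // (leq_trans (jh x)) ?leq_addr.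
  have h'n : (\sum_x h' x)%N = n.
    have : (\sum_x (h' x + j * M) = \sum_x (h x + j * B * count_mem x S))%N.
      by apply: eq_bigr => x _.
    rewrite !big_split /= nE sum_nat_const -big_distrr /= card_cube card_ord.
    have -> : (\sum_x count_mem x S)%N = M.
      rewrite /M -(count_predT S) -sum_count_mem.
      by apply: eq_bigr => x _; rewrite mul1n.
    by rewrite mulnCA mulnA => /addIn.
  have [w wE] := exists_fun_histogram h'n.
  exists (mat_of_rows w) => _; split=> [|A g Ad gA].
    have -> : #|[set i | P (row_of (mat_of_rows w) i)]| = (\sum_i P (w i))%N.
      rewrite -sum1_card big_mkcond; apply: eq_bigr => i _.
      by rewrite inE mat_of_rowsK; case: (P _).
    rewrite (sum_nat_histogram w (fun x => P x : nat)).
    have : (\sum_x P x * (h' x + j * M) = \sum_x P x * (h x + j * B * count_mem x S))%N.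
      by apply: eq_bigr => x _; rewrite h'E.
    under eq_bigr do rewrite mulnDr -wE.
    under [X in _ = X -> _]eq_bigr do rewrite mulnDr mulnCA.
    rewrite !big_split /= -big_distrl -big_distrr /= sum_count_mem -/b.
    have -> : (\sum_x P x * h x)%N = c by rewrite -(sum_nat_histogram (row_of y) (fun x => P x : nat)).
    have -> : (\sum_x P x)%N = p.
      by rewrite /p -sum1_card [RHS]big_mkcond; apply: eq_bigr => x _; rewrite unfold_in; case: (P x).
    rewrite -cjm -mulnA [(B * b)%N]mulnC -DE => E; apply: (@addIn (p * (j * M))).
    by rewrite E; ring.
  have gE (w' : 'I_n -> cube 'I_k) : \sum_i g (w' i) =
      \sum_x #|[set i | w' i == x]|%:R * g x.
    by rewrite sum_histogram; apply: eq_bigr => x _; rewrite mulr_natl.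
  rewrite (eq_bigr (fun i => g (w i))) => [|i _]; last by rewrite mat_of_rowsK.
  (* Adding the removed mass back to both sides avoids subtraction; what remains is
     [unif_multiset_low_degree]. *)
  rewrite !gE; apply: (addIr ((j * M)%:R * \sum_x g x)).
  rewrite mulr_sumr -big_split /=.
  rewrite (eq_bigr (fun x => (h x)%:R * g x + j%:R * (B%:R * ((count_mem x S)%:R * g x)))).
    rewrite big_split /= -!mulr_sumr (unif_multiset_low_degree M0 dk Sd Ad gA).
    by rewrite natrM mulrA.
  move=> x _; rewrite wE -mulrDl -natrD h'E natrD !natrM; ring.
have [f fE] := fin_all_exists star.
exists n, m; split.
- by rewrite /n !muln_gt0 M0 N0 B0 (ltnW q1).
- exact: (exact_count_of_histograms Zdist Zd fE).
- by rewrite /m /n; ring.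
Qed.

End ExactCount.

(** * One number of rows for all multisets *)

Section UniformRate.
Variable R : realType.

Lemma exact_count_le k d (P : cube 'I_k -> bool) n m : exact_count R d P n m -> (m <= n)%N.
Proof.
move=> [theta [[_ theta1] _ thetaP]].
have [y y0] : exists y, theta y != 0.
  apply: contrapT => H; have := oner_neq0 R; rewrite -theta1 big1 ?eqxx // => y _.
  by apply/eqP/negbNE/negP => y0; apply: H; exists y.
by rewrite -(thetaP y y0) -[X in (_ <= X)%N]card_ord max_card.
Qed.

(* A single [n] serves all multisets: take an exact count whose rate is within [eps / 2]
   of the supremum of all achievable rates. *)
Lemma exists_uniform_exact_count k d (P : cube 'I_k -> bool) (eps : R) :
  0 < eps -> (d <= k)%N ->
  exists n, forall S : seq (cube 'I_k), wise_uniform d (unif_multiset R S) ->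
    (#|P| * size S < count P S * 2 ^ k)%N ->
    exists m, [/\ (0 < n)%N, exact_count R d P n m &
      (count P S)%:R / (size S)%:R - eps <= m%:R / n%:R].
Proof.
move=> eps0 dk.
pose E : set R := fun x => exists n m,
  [/\ (0 < n)%N, exact_count R d P n m & x = m%:R / n%:R].
have E1 x : E x -> x <= 1.
  move=> [n [m [n0 /exact_count_le mn ->]]].
  by rewrite ler_pdivrMr ?ltr0n // mul1r ler_nat.
have rate (S : seq (cube 'I_k)) : wise_uniform d (unif_multiset R S) ->
    (#|P| * size S < count P S * 2 ^ k)%N ->
    exists2 x, E x & (count P S)%:R / (size S)%:R - eps / 2 <= x.
  move=> Sd PS; set M := size S; set b := count P S.
  have bM : (b <= M)%N by apply: count_size.
  have M0 : (0 < M)%N.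
    by rewrite lt0n; apply: contraTneq PS => /size0nil S0; rewrite S0 -leqNgt.
  have MR : 0 < M%:R :> R by rewrite ltr0n.
  (* The first bound is the hypothesis of [exists_exact_count]; the second makes the loss
     [b / M / q] at most [eps / 2]. *)
  pose q := maxn (M * 2 ^ k).+1 (Num.trunc (2 / eps)).+1.
  have q0 : (0 < q)%N by rewrite leq_max.
  have qR : 0 < q%:R :> R by rewrite ltr0n.
  have [|n [m [n0 nm mE]]] := exists_exact_count (q := q) dk Sd PS.
    by rewrite leq_max leqnn.
  exists (m%:R / n%:R); first by exists n, m.
  have nR : 0 < n%:R :> R by rewrite ltr0n.
  have -> : m%:R / n%:R = b%:R / M%:R - b%:R / M%:R / q%:R :> R.
    have qE : q.-1%:R = q%:R - 1 :> R by rewrite -[in RHS](prednK q0) -natr1 addrK.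
    have : m%:R * (q%:R * M%:R) = (q%:R - 1) * b%:R * n%:R :> R.
      by rewrite -qE -!natrM mE.
    move=> h; apply: (mulIf (lt0r_neq0 nR)); rewrite divfK ?gt_eqF //.
    apply: (mulIf (lt0r_neq0 (mulr_gt0 qR MR))); rewrite h.
    by field; rewrite !gt_eqF.
  rewrite lerD2l lerN2 ler_pdivrMr //; apply: (@le_trans _ _ 1).
    by rewrite ler_pdivrMr // mul1r ler_nat.
  rewrite mulrC -ler_pdivrMr ?divr_gt0 // div1r invf_div; apply: ltW.
  by apply: lt_le_trans (truncnS_gt _) _; rewrite ler_nat leq_maxr.
(* If no rate is achievable, then by [rate] no [S] satisfies the hypotheses, and any [n] will do. *)
case: (pselect (exists x, E x)) => [E0|E0]; last first.
  by exists 0%N => S Sd PS; have [x Ex _] := rate S Sd PS; case: E0; exists x.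
have supE : has_sup E by split=> //; exists 1 => x /E1.
have eps2 : 0 < eps / 2 by rewrite divr_gt0.
have [_ [n [m [n0 nm ->]]] mn] := sup_adherent eps2 supE.
exists n => S Sd PS; exists m; split=> //.
have [x Ex xle] := rate S Sd PS.
have : x <= sup E by apply: sup_upper_bound.
by move: mn xle; set a := (count P S)%:R / _; set c := m%:R / _; lra.
Qed.

End UniformRate.

Theorem theorem8 (R : realType) (k : nat) (eps : R) (eps_gt0 : 0 < eps) :
  exists C : R,
  forall (P : cube 'I_k -> bool) (t : nat) (nu : {ffun cube 'I_k -> R})
         (S : seq (cube 'I_k)) (beta : R),
    (2 <= t)%N ->
    is_dist nu ->
    wise_uniform (t - 1) nu ->
    nu = unif_multiset R S ->
    expect nu P = beta ->
    expect (unif R (cube 'I_k)) P < beta ->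
  exists (r : nat) (teps : rat)
         (theta : {ffun cube ('I_r * 'I_k)%type -> R}),
    [/\ (0 < r)%N,
        r%:R <= C * (size S)%:R ^+ 4,
        ratr teps <= eps,
        is_dist theta /\ wise_uniform (t - 1) theta &
        forall y : cube ('I_r * 'I_k)%type, theta y != 0 ->
          #|[set i : 'I_r | P (row_of y i)]|%:R = (beta - ratr teps) * r%:R].
Proof.
have rate (Pd : {ffun cube 'I_k -> bool} * 'I_k.+1) := exists_uniform_exact_count
  (d := Pd.2) Pd.1 eps_gt0 (ltnSE (ltn_ord Pd.2)).
have [n0 n0P] := fin_all_exists rate.
(* The sum dominates every [n0 Pd]; the summand 1 covers the single-row case. *)
exists (1 + \sum_Pd (n0 Pd)%:R) => P t nu S beta t2 [_ nu1] nu_unif nuS betaE beta_gt.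
rewrite {}nuS in nu1 nu_unif betaE; rewrite -{}betaE in beta_gt *.
(* For empty [S] division by zero gives the zero function, whose total mass is not 1. *)
have S0 : (0 < size S)%N.
  rewrite lt0n; apply: contra_eq_neq nu1 => S0.
  rewrite big1 ?(eq_sym 0) ?oner_neq0 // => x _.
  by rewrite ffunE S0 invr0 mulr0.
have SR : 0 < (size S)%:R :> R by rewrite ltr0n.
have S4 : 1 <= (size S)%:R ^+ 4 :> R by rewrite exprn_ege1 // ler1n.
have PS : (#|P| * size S < count P S * 2 ^ k)%N.
  move: beta_gt; rewrite expect_multiset expect_unif.
  rewrite ltr_pdivlMr // mulrAC ltr_pdivrMr ?ltr0n ?expn_gt0 //.
  by rewrite -!natrM ltr_nat.
rewrite expect_multiset.
pose rate_rat n m : rat := (count P S)%:R / (size S)%:R - m%:R / n%:R.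
have rate_ratE n m : ratr (rate_rat n m) =
    (count P S)%:R / (size S)%:R - m%:R / n%:R :> R.
  by rewrite rmorphB !fmorph_div !rmorph_nat.
have [dk|kd] := leqP (t - 1) k.
- pose Pd : {ffun cube 'I_k -> bool} * 'I_k.+1 := (finfun P, Ordinal (dk : t - 1 < k.+1)%N).
  have PE : Pd.1 =1 P by apply: ffunE.
  have [||m [n_gt0 [theta [theta_dist theta_d thetaP]] mn]] := n0P Pd S.
  + exact: nu_unif.
  + by rewrite (eq_card PE) (eq_count PE).
  exists (n0 Pd), (rate_rat (n0 Pd) m), theta; split=> //.
  + rewrite -[X in X <= _]mulr1; apply: ler_pM => //.
    by rewrite (bigD1 Pd) //= addrCA lerDl addr_ge0 // sumr_ge0.
  + by rewrite rate_ratE; move: mn; rewrite (eq_count PE); lra.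
  + move=> y /thetaP <-; rewrite rate_ratE subKr divfK ?pnatr_eq0 -?lt0n //.
    by congr (_%:R); apply: eq_card => i; rewrite !inE PE.
(* When [t - 1 > k], a 1 by [k] matrix has no [t - 1] entries. A point mass at a row satisfying [P]
   serves, with [teps = b / M - 1 <= 0]. *)
- have [x Px] : exists x, P x.
    have /hasP[x _ Px] : has P S.
      by rewrite has_count; case: (count P S) PS.
    by exists x.
  pose y0 : cube ('I_1 * 'I_k)%type := mat_of_rows (fun _ => x).
  exists 1%N, (rate_rat 1%N 1%N), [ffun y => (y == y0)%:R]; split=> //.
  + apply: (@le_trans _ _ (1 + \sum_Pd (n0 Pd)%:R)).
      by rewrite lerDl sumr_ge0.
    by rewrite ler_peMr // addr_ge0 // sumr_ge0.
  + rewrite rate_ratE divr1; apply: (@le_trans _ _ 0); last exact: ltW.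
    by rewrite subr_le0 ler_pdivrMr // mul1r ler_nat count_size.
  + split; first split.
    * by move=> y; rewrite ffunE ler0n.
    * rewrite (bigD1 y0) //= ffunE eqxx big1 ?addr0 // => y.
      by rewrite ffunE; case: eqP => // ->; rewrite eqxx.
    * move=> A At; have := max_card A.
      by rewrite card_prod !card_ord mul1n At leqNgt kd.
  + move=> y; rewrite ffunE; case: (y =P y0) => [->|]; last by rewrite eqxx.
    move=> _; rewrite rate_ratE subKr divr1 mulr1.
    rewrite -[RHS](mulr1n 1); congr (_%:R); rewrite -[RHS](card_ord 1).
    by apply: eq_card => i; rewrite !inE mat_of_rowsK Px.
Qed.
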